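(* Fix $h\in\mathbb{R}$ and let $\{x_j\}_j=\operatorname{Sp}(A_h)$. Define $G_h(z):=1/F_h(z)=h+1/F(z)$. Then, for every $f\in\widehat{\mathcal{H}}_\mu$, $$f(z)=\sum_{x_j\in\operatorname{Sp}(A_h)}\frac{G_h(z)}{(z-x_j)\,G_h'(x_j)}\,f(x_j),\qquad z\in\mathbb{C}\setminus\operatorname{Sp}(A_\infty),$$ and the series is uniformly convergent on every compact subset of $\mathbb{C}\setminus\operatorname{Sp}(A_\infty)$.
   Context: Let $\mathcal{H}$ be a separable Hilbert space with inner product $\langle\cdot,\cdot\rangle$ anti-linear in the first argument. Let $A$ be a (possibly unbounded) self-adjoint operator in $\mathcal{H}$ with discrete spectrum of multiplicity one (its spectrum consists only of isolated eigenvalues, each of multiplicity one). Let $\mu\in\mathcal{H}$ be a cyclic vector for $A$ (i.e. $\{(A-zI)^{-1}\mu : z\in\mathbb{C}\setminus\operatorname{Sp}(A)\}$ is a total set in $\mathcal{H}$) with $\|\mu\|=1$. $\operatorname{Sp}(\cdot)$ denotes the spectrum. For $h\in\mathbb{R}$ let $A_h:=A+h\langle\mu,\cdot\rangle\mu$ with $\operatorname{Dom}(A_h)=\operatorname{Dom}(A)$; each $A_h$ is self-adjoint with discrete spectrum. Let $F_h(z):=\langle\mu,(A_h-zI)^{-1}\mu\rangle$ for $z\notin\operatorname{Sp}(A_h)$, and $F:=F_0$; these are meromorphic functions on $\mathbb{C}$, and $F_h=F/(1+hF)$. $A_\infty$ denotes the perturbation with infinite coupling $h=\infty$; its spectrum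 is $\operatorname{Sp}(A_\infty)=\{x\in\mathbb{R}:F(x)=0\}$. It is disjoint from $\operatorname{Sp}(A_h)$ for every $h\in\mathbb{R}$. Define $\xi(z):=\dfrac{(A-\overline{z}I)^{-1}\mu}{F(\overline{z})}$ for $z\in\mathbb{C}\setminus\operatorname{Sp}(A_\infty)$, where at points of $\operatorname{Sp}(A)$ (poles of $F$) the value is understood as the limit. For $\varphi\in\mathcal{H}$ define $(\Phi_\mu\varphi)(z):=\langle\xi(z),\varphi\rangle$, $z\in\mathbb{C}\setminus\operatorname{Sp}(A_\infty)$, and $\widehat{\mathcal{H}}_\mu:=\Phi_\mu\mathcal{H}$, a linear space of meromorphic functions. Removable singularities are filled in by continuity: $1/F$ takes the value $0$ at the points of $\operatorname{Sp}(A)$, and $G_h(z)/(z-x_j)$ takes the value $G_h'(x_j)$ at $z=x_j$. *)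

(* Defs.v *)
From HB Require Import structures.
From mathcomp Require Import all_boot all_order all_algebra.
From mathcomp Require Import sesquilinear complex.
From mathcomp Require Import all_classical all_reals all_analysis.
From mathcomp Require Import finmap showcase.summability.

Set Implicit Arguments.
Unset Strict Implicit.
Unset Printing Implicit Defensive.

Import Order.TTheory GRing.Theory Num.Theory.
Import numFieldNormedType.Exports.

Local Open Scope classical_set_scope.
Local Open Scope ring_scope.

(* The metric topology of R[i], as MathComp-Analysis provides it for an abstract
   [numClosedFieldType]. *)
HB.instance Definition _ (R : rcfType) := GRing.ComAlgebra.copy R[i] R[i]^o.
HB.instance Definition _ (R : rcfType) := Vector.copy R[i] R[i]^o.
HB.instance Definition _ (R : rcfType) := NormedModule.copy R[i] R[i]^o.

Definition separable (T : topologicalType) :=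
  exists2 D : set T, countable D & dense D.

Definition total_family (K : numFieldType) (V : normedModType K) (S : set V) :=
  dense [set v : V | exists (n : nat) (c : 'I_n -> K) (w : 'I_n -> V),
    (forall i, S (w i)) /\ v = \sum_(i < n) c i *: w i].

(* A partial linear map H -> H; [op_fun] is meaningless outside [op_dom]. *)
Record operator (K : numFieldType) (H : normedModType K) := Operator {
  op_dom : set H;
  op_fun :> H -> H;
  op_dom0 : op_dom 0;
  op_domP : forall a u v, op_dom u -> op_dom v -> op_dom (a *: u + v);
  op_linear : forall a u v, op_dom u -> op_dom v ->
    op_fun (a *: u + v) = a *: op_fun u + op_fun v }.

Lemma operator_ext (K : numFieldType) (H : normedModType K)
    (S T : operator H) :
  op_dom S = op_dom T -> op_fun S = op_fun T -> S = T.
Proof.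
case: S T => D f D0 DP fl [D' f' D0' DP' fl'] /= eD ef.
by subst D' f'; congr Operator; exact: Prop_irrelevance.
Qed.

Section Operator.
Variables (K : numFieldType) (H : completeNormedModType K).
Implicit Types (T : operator H) (z : K).

Definition resolvent_set T : set K :=
  [set z | exists B : H -> H,
    [/\ continuous B,
        forall u, op_dom T (B u) /\ T (B u) - z *: B u = u &
        forall v, op_dom T v -> B (T v - z *: v) = v]].

Definition spectrum T : set K := ~` resolvent_set T.

(* (T - z)^-1; the value is irrelevant when [z] is in the
   spectrum of [T]. *)
Definition resolvent T z (u : H) : H :=
  xget 0 [set v | op_dom T v /\ T v - z *: v = u].

Definition eigenspace T z : set H :=
  [set v | op_dom T v /\ T v = z *: v].

Definition discrete_simple_spectrum T :=
  forall z, spectrum T z ->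
    isolated (spectrum T) z /\
    exists2 e : H, e != 0 & eigenspace T z = range (fun c : K => c *: e).

End Operator.

(* The forms [{dot H for Num.conj}] are antilinear in their SECOND argument,
   whence the swap: [inner dot u v] is <u, v>, antilinear in [u]. *)
Definition inner (C : numClosedFieldType) (H : lmodType C)
  (dot : {dot H for (Num.conj : C -> C)}) (u v : H) : C := dot v u.

Section Perturbation.
Variables (R : realType) (H : completeNormedModType R[i]).
Variable dot : {dot H for (Num.conj : R[i] -> R[i])}.
Local Notation C := (R[i]).
Local Notation "<< u , v >>" := (inner dot u v).
Implicit Types (T : operator H) (u v w : H) (z x : C) (h : R).

(* T = T^*: the pairs (v, w) with <w, u> = <v, T u> for all u in the domain
   form the graph of T^*. *)
Definition self_adjoint T :=
  dense (op_dom T) /\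
  forall v w, (op_dom T v /\ T v = w) <->
    (forall u, op_dom T u -> << w, u >> = << v, T u >>).

Definition cyclic T (mu : H) :=
  total_family [set resolvent T z mu | z in ~` spectrum T].

Definition perturb_fun T mu h v : H := T v + (h%:C%C * << mu, v >>) *: mu.

Lemma perturb_linear T mu h a u v : op_dom T u -> op_dom T v ->
  perturb_fun T mu h (a *: u + v)
  = a *: perturb_fun T mu h u + perturb_fun T mu h v.
Proof.
move=> Tu Tv; rewrite /perturb_fun /inner op_linear// linearPl/=.
by rewrite mulrDr mulrCA scalerDl scalerDr addrACA scalerA.
Qed.

(* T_h = T + h <mu, .> mu *)
Definition perturb T mu h : operator H :=
  Operator (op_dom0 T) (@op_domP _ _ T) (@perturb_linear T mu h).

Lemma perturb0 T mu : perturb T mu 0 = T.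
Proof.
apply: operator_ext => //; apply/funext => v /=.
by rewrite /perturb_fun mul0r scale0r addr0.
Qed.

(* F_h is [Ffun (perturb A mu h) mu]; by [perturb0], F = F_0 is [Ffun A mu]. *)
Definition Ffun T mu z : C := << mu, resolvent T z mu >>.

(* Sp(A_oo); F is meromorphic with poles on Sp(A), so that its zeros lie
   outside Sp(A). *)
Definition spectrum_infty T mu : set C :=
  [set x%:C%C | x in [set x : R | ~ spectrum T x%:C%C /\ Ffun T mu x%:C%C = 0]].

Definition xi_regular T mu z : H :=
  (Ffun T mu (Num.conj z))^-1 *: resolvent T (Num.conj z) mu.

Definition xi T mu z : H :=
  if `[< spectrum T z >] then lim (xi_regular T mu w @[w --> z^'])
  else xi_regular T mu z.

Definition Phi T mu (phi : H) z : C := << xi T mu z, phi >>.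

(* The elements of the range of Phi are functions on the complement of
   [spectrum_infty T mu], hence compared there only. *)
Definition Hhat T mu : set (C -> C) :=
  [set f | exists phi, forall z, ~ spectrum_infty T mu z ->
    f z = Phi T mu phi z].

(* 1/F, with the value 0 at the poles of F. *)
Definition recipF T mu z : C :=
  if `[< spectrum T z >] then 0 else (Ffun T mu z)^-1.

Definition Gfun T mu h : C -> C := recipF (perturb T mu h) mu.

(* G_h(z) / (z - x), for x a zero of G_h. *)
Definition Gquot T mu h x z : C :=
  if z == x then derive1 (Gfun T mu h) x else Gfun T mu h z / (z - x).

Definition sampling_term T mu h (f : C -> C) x z : C :=
  Gquot T mu h x z / derive1 (Gfun T mu h) x * f x.

(* The sum over a finite part [J] of Sp(A_h). *)
Definition sampling_sum T mu h (f : C -> C)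
    (J : {fset set_type (spectrum (perturb T mu h))}) (z : C) : C :=
  partial_sum (fun x : set_type (spectrum (perturb T mu h)) =>
    sampling_term T mu h f (val x) z) J.

End Perturbation.

(* Main.v *)
Require Import Defs.
From mathcomp Require Import all_boot all_order all_algebra.
From mathcomp Require Import sesquilinear complex.
From mathcomp Require Import all_classical all_reals all_analysis.
From mathcomp Require Import finmap showcase.summability.
From mathcomp Require Import ring lra.
Import Order.TTheory GRing.Theory Num.Theory.
Import numFieldNormedType.Exports.
Local Open Scope classical_set_scope.
Local Open Scope ring_scope.

(** The vector [xi z] is the unique solution of [(A - z^* ) v = k mu] with
    [<mu, v> = 1] (then [k = 1 / F z^*]), also when [z] is an eigenvalue of [A],
    where [k = 0]. Hence [(A_h - z^* ) (xi z) = G_h(z^* ) mu]: the spectrum of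
    [A_h] is the zero set of [G_h], [xi x] is the eigenvector of [A_h] at such a
    zero [x], and self-adjointness gives [G_h(z) = (x - z) <xi z, xi x>]. So
    [G_h'(x) = - |xi x|^2], and the partial sums of the sampling series are
    [<xi z, P phi>], with [P] the orthogonal projection on the span of finitely
    many of the [xi x]. The convergence is therefore that of [P phi] to [phi],
    uniform wherever [xi] is bounded.

    Two facts replace the spectral theorem: for an isolated eigenvalue [l] with
    simple eigenvector [e], [A - l] is bounded below on the orthogonal of [e];
    and a self-adjoint operator all of whose spectrum is of this kind has a
    total family of eigenvectors. Both come from one remark: if [b] is the norm
    of a bounded symmetric operator [B], then [b - B] or [b + B] is not bounded
    below. *)

Set Implicit Arguments.
Unset Strict Implicit.

(** * Complex numbers: real embedding, conjugation, real-valued modulus *)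

Section ComplexNumbers.
Variable R : realType.
Implicit Types (x y : R) (a b z : R[i]).

Definition cr x : R[i] := (x%:C)%C.
Definition cj z : R[i] := Num.conj z.
(** The norm on [R[i]] is complex-valued, over a partial order. Its real part brings estimates into
    the total order of [R], where [lra] applies and infima exist; [nm] does the same for vectors. *)
Definition nc z : R := complex.Re `|z|.

Lemma crI : injective cr. Proof. exact: complexI. Qed.
Lemma crD x y : cr (x + y) = cr x + cr y. Proof. exact: rmorphD. Qed.
Lemma crN x : cr (- x) = - cr x. Proof. exact: rmorphN. Qed.
Lemma crM x y : cr (x * y) = cr x * cr y. Proof. exact: rmorphM. Qed.
Lemma crV x : cr x^-1 = (cr x)^-1. Proof. exact: fmorphV. Qed.
Lemma cr0 : cr 0 = 0. Proof. by []. Qed.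
Lemma cr1 : cr 1 = 1. Proof. by []. Qed.
Lemma crX x n : cr (x ^+ n) = cr x ^+ n. Proof. exact: rmorphXn. Qed.
Definition crE := (crD, crN, crM, crV, cr0, cr1, crX).

Lemma cr_eq0 x : (cr x == 0) = (x == 0).
Proof. by rewrite -cr0 (inj_eq crI). Qed.

Lemma ltcr x y : (cr x < cr y) = (x < y). Proof. exact: ltcR. Qed.
Lemma lecr x y : (cr x <= cr y) = (x <= y). Proof. exact: lecR. Qed.

Lemma cjD a b : cj (a + b) = cj a + cj b. Proof. exact: rmorphD. Qed.
Lemma cjN a : cj (- a) = - cj a. Proof. exact: rmorphN. Qed.
Lemma cjM a b : cj (a * b) = cj a * cj b. Proof. exact: rmorphM. Qed.
Lemma cjV a : cj a^-1 = (cj a)^-1. Proof. exact: fmorphV. Qed.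
Lemma cjK a : cj (cj a) = a. Proof. exact: conjCK. Qed.
Lemma cj0 : cj 0 = 0. Proof. exact: conjC0. Qed.
Lemma cj1 : cj 1 = 1. Proof. exact: conjC1. Qed.
Lemma cj_cr x : cj (cr x) = cr x.
Proof. by apply/CrealP/complex_realP; exists x. Qed.

Lemma cj_fix z : cj z = z -> z = cr (complex.Re z).
Proof. by move/CrealP/RRe_real. Qed.

Lemma Re_cr x : complex.Re (cr x) = x. Proof. by []. Qed.
Lemma Re_cj a : complex.Re (cj a) = complex.Re a. Proof. by case: a. Qed.
Lemma ReD a b : complex.Re (a + b) = complex.Re a + complex.Re b.
Proof. by case: a b => ? ? []. Qed.
Lemma ReN a : complex.Re (- a) = - complex.Re a. Proof. by case: a. Qed.
Lemma Re_crM x a : complex.Re (cr x * a) = x * complex.Re a.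
Proof. by case: a => u v /=; rewrite mul0r subr0. Qed.

Lemma ncE z : `|z| = cr (nc z).
Proof. by rewrite /nc /cr RRe_real// ger0_real. Qed.

Lemma nc_ge0 z : 0 <= nc z.
Proof. by rewrite -lecr -ncE normr_ge0. Qed.

Lemma nc0 : nc 0 = 0. Proof. by rewrite /nc normr0. Qed.

Lemma nc_gt0 z : (0 < nc z) = (z != 0).
Proof. by rewrite -ltcr -ncE normr_gt0. Qed.

Lemma ncM a b : nc (a * b) = nc a * nc b.
Proof. by apply: crI; rewrite crE -!ncE normrM. Qed.

Lemma ncN a : nc (- a) = nc a.
Proof. by rewrite /nc normrN. Qed.

Lemma ncD a b : nc (a + b) <= nc a + nc b.
Proof. by rewrite -lecr crE -!ncE ler_normD. Qed.

Lemma nc_cj a : nc (cj a) = nc a.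
Proof. by apply: crI; rewrite -!ncE norm_conjC. Qed.

Lemma nc_cr x : nc (cr x) = `|x|.
Proof. by apply: crI; rewrite -ncE normc_def/= expr0n addr0 sqrtr_sqr. Qed.

Lemma nc_sqr a : cr (nc a ^+ 2) = a * cj a.
Proof. by rewrite crE -ncE normCK. Qed.

Lemma pos_cr (e : R[i]) : 0 < e -> exists2 r : R, 0 < r & e = cr r.
Proof.
move=> e0; exists (complex.Re e); first by move: e0; rewrite ltcE => /andP[].
by rewrite /cr RRe_real// gtr0_real.
Qed.

End ComplexNumbers.

(** * Real-valued norm, and limits and density in terms of it *)

Section RealNorm.
Variables (R : realType) (V : normedModType R[i]).
Implicit Types u v : V.

Definition nm u : R := complex.Re `|u|.

Lemma nmE u : `|u| = cr (nm u).
Proof. by rewrite /nm /cr RRe_real// ger0_real. Qed.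

Lemma nm_ge0 u : 0 <= nm u.
Proof. by rewrite -lecr -nmE normr_ge0. Qed.

Lemma nm0 : nm 0 = 0.
Proof. by rewrite /nm normr0. Qed.

Lemma nm_gt0 u : (0 < nm u) = (u != 0).
Proof. by rewrite -ltcr -nmE normr_gt0. Qed.

Lemma nm0_eq0 u : nm u <= 0 -> u = 0.
Proof. by apply: contraPeq; rewrite -nm_gt0 ltNge => /negP. Qed.

Lemma nmN u : nm (- u) = nm u.
Proof. by rewrite /nm normrN. Qed.

Lemma nmBC u v : nm (u - v) = nm (v - u).
Proof. by rewrite -nmN opprB. Qed.

Lemma nmD u v : nm (u + v) <= nm u + nm v.
Proof. by rewrite -lecr crE -!nmE ler_normD. Qed.

Lemma nmB u v : nm (u - v) <= nm u + nm v.
Proof. by rewrite -(nmN v) nmD. Qed.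

Lemma nmZ (a : R[i]) u : nm (a *: u) = nc a * nm u.
Proof. by apply: crI; rewrite crE -ncE -!nmE normrZ. Qed.

Lemma nbhs_nm u (P : set V) :
  nbhs u P <-> exists2 e : R, 0 < e & forall v, nm (v - u) < e -> P v.
Proof.
rewrite -nbhs_nbhs_norm; split.
  move=> [e /= /pos_cr[r r0 ->] eP]; exists r => // v vu.
  by apply: eP => /=; rewrite distrC nmE ltcr.
move=> [e e0 eP]; exists (cr e); first by rewrite /= ltcr.
by move=> v /=; rewrite distrC nmE ltcr; exact: eP.
Qed.

Lemma cvg_nm (T : Type) (F : set_system T) (FF : Filter F) (f : T -> V) u :
  f @ F --> u <-> forall e : R, 0 < e -> \forall t \near F, nm (f t - u) < e.
Proof.
split=> [fu e e0|fu P /nbhs_nm[e e0 eP]].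
  by apply: (fu [set v | nm (v - u) < e]); apply/nbhs_nm; exists e.
by apply: filterS (fu e e0) => t; exact: eP.
Qed.

Lemma dense_nm (D : set V) :
  dense D <-> forall v (e : R), 0 < e -> exists2 d, D d & nm (d - v) < e.
Proof.
split=> [dD v e e0|dD O [v Ov] oO].
  pose O := [set d | nm (d - v) < e].
  have nO : nbhs v O by apply/nbhs_nm; exists e.
  have [||d [/interior_subset Od Dd]] := dD (interior O); last by exists d.
  - by exists v.
  - exact: open_interior.
have /nbhs_nm[e e0 eO] : nbhs v O by apply: open_nbhs_nbhs.
by have [d Dd dv] := dD v e e0; exists d; split => //; exact: eO.
Qed.

Lemma dnbhs_nm u (P : set V) :
  u^' P <-> exists2 e : R, 0 < e & forall v, v != u -> nm (v - u) < e -> P v.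
Proof.
rewrite /dnbhs /within /=; split.
  by move=> /nbhs_nm[e e0 eP]; exists e => // y yx /eP; exact.
by move=> [e e0 eP]; apply/nbhs_nm; exists e => // y ye yx; exact: eP.
Qed.

End RealNorm.

Lemma nm_scalar (R : realType) (z : R[i]) : nm z = nc z.
Proof. by []. Qed.

Arguments nm0 {R V}.

Lemma sqr_le (R : realDomainType) (x y : R) :
  0 <= x -> 0 <= y -> (x ^+ 2 <= y ^+ 2) = (x <= y).
Proof. by move=> x0 y0; rewrite ler_pXn2r. Qed.

(** Cantor's intersection argument without sequences: the sets [S e] generate a Cauchy filter. They
    are not assumed closed, so its limit [p] is only approached by their points. *)
Lemma shrinking_limit (R : realType) (V : completeNormedModType R[i])
    (S : R -> set V) :
  (forall e, 0 < e -> S e !=set0) ->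
  (forall e e', e <= e' -> S e `<=` S e') ->
  (forall e, 0 < e -> exists2 d, 0 < d &
     forall u v, S d u -> S d v -> nm (u - v) < e) ->
  exists p, forall e, 0 < e -> exists2 u, S e u & nm (u - p) < e.
Proof.
move=> Sn Sm Sd; pose F := filter_from [set d : R | 0 < d] S.
have FF : ProperFilter F.
  apply: filter_from_proper => [|//].
  apply: filter_from_filter; first by exists 1; rewrite /= ltr01.
  move=> d d' /= d0 d'0; exists (Num.min d d'); first by rewrite /= lt_min d0.
  by move=> u Su; split; apply: Sm Su; rewrite ge_min lexx// orbT.
have cF : cvg F.
  apply: cauchy_cvg; apply: cauchy_exP => _ /pos_cr[e e0 ->].
  have [d d0 Sde] := Sd e e0; have [u Su] := Sn d d0.
  exists u; exists d => // v Sv; rewrite -ball_normE /= nmE ltcr.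
  exact: Sde.
exists (lim F) => e e0.
have Fl : F [set u | nm (u - lim F) < e] by apply: cF; apply/nbhs_nm; exists e.
have FS : F (S e) by exists e.
have /filter_ex[u [Su ul]] : F (S e `&` [set u | nm (u - lim F) < e]).
  exact: filterI.
by exists u.
Qed.

(** * Geometry of the inner product and norms of symmetric operators *)

Section Hilbert.
Variables (R : realType) (H : completeNormedModType R[i]).
Variable dot : {dot H for (Num.conj : R[i] -> R[i])}.
Hypothesis dot_norm : forall u : H, inner dot u u = `|u| ^+ 2.
Implicit Types (u v w : H) (a : R[i]).

Definition ip u v : R[i] := inner dot u v.
Local Notation "<< u , v >>" := (ip u v).

Lemma ipC u v : << v, u >> = cj << u, v >>.
Proof. by rewrite /ip /inner hermC expr0 mul1r. Qed.

Lemma ipDl u v w : << u + v, w >> = << u, w >> + << v, w >>.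
Proof. by rewrite /ip /inner linearDr. Qed.

Lemma ipDr u v w : << w, u + v >> = << w, u >> + << w, v >>.
Proof. by rewrite /ip /inner linearDl. Qed.

Lemma ipZl a u v : << a *: u, v >> = cj a * << u, v >>.
Proof. by rewrite /ip /inner linearZr_LR. Qed.

Lemma ipZr a u v : << u, a *: v >> = a * << u, v >>.
Proof. by rewrite /ip /inner linearZl_LR. Qed.

Lemma ip0l u : << 0, u >> = 0.
Proof. by rewrite /ip /inner linear0r. Qed.

Lemma ip0r u : << u, 0 >> = 0.
Proof. by rewrite /ip /inner linear0l. Qed.

Lemma ipNl u v : << - u, v >> = - << u, v >>.
Proof. by rewrite /ip /inner linearNr. Qed.

Lemma ipNr u v : << u, - v >> = - << u, v >>.
Proof. by rewrite /ip /inner linearNl. Qed.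

Definition ipE := (ipDl, ipDr, ipZl, ipZr, ip0l, ip0r, ipNl, ipNr).

Lemma nm_sqr u : << u, u >> = cr (nm u ^+ 2).
Proof. by rewrite /ip dot_norm nmE -crX. Qed.

Lemma nm_sqrRe u : nm u ^+ 2 = complex.Re << u, u >>.
Proof. by rewrite nm_sqr. Qed.

Lemma ip_eq0C u v : << u, v >> = 0 -> << v, u >> = 0.
Proof. by move=> uv; rewrite ipC uv cj0. Qed.

Lemma ip_inj u v : (forall w, << w, u >> = << w, v >>) -> u = v.
Proof.
move=> uv; apply/eqP; rewrite -subr_eq0; apply/eqP/nm0_eq0.
have : nm (u - v) ^+ 2 = 0 by rewrite nm_sqrRe ipDr ipNr uv subrr.
by move/eqP; rewrite sqrf_eq0 => /eqP ->.
Qed.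

(* Testing both sides against an arbitrary vector turns an identity of the
   module [H] into one of the field [R[i]], where [ring] applies. *)
Ltac vect := apply: ip_inj => ?; rewrite ?(ipDr, ipNr, ipZr, ip0r); ring.

Lemma nmD2 u v :
  nm (u + v) ^+ 2 = nm u ^+ 2 + nm v ^+ 2 + 2 * complex.Re << u, v >>.
Proof. by rewrite !nm_sqrRe !ipE !ReD (ipC u v) Re_cj; ring. Qed.

Lemma nmB2 u v :
  nm (u - v) ^+ 2 = nm u ^+ 2 + nm v ^+ 2 - 2 * complex.Re << u, v >>.
Proof. by rewrite nmD2 nmN ipNr ReN; ring. Qed.

Lemma pythagoras u v : << u, v >> = 0 -> nm (u + v) ^+ 2 = nm u ^+ 2 + nm v ^+ 2.
Proof. by move=> uv; rewrite nmD2 uv /= mulr0 addr0. Qed.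

Lemma parallelogram u v :
  nm (u + v) ^+ 2 + nm (u - v) ^+ 2 = 2 * nm u ^+ 2 + 2 * nm v ^+ 2.
Proof. by rewrite nmD2 nmB2; ring. Qed.

Lemma nm_le_orth u v : << u, v >> = 0 -> nm u <= nm (u + v).
Proof.
move=> /pythagoras uv; rewrite -(@ler_pXn2r _ 2)// ?nnegrE ?nm_ge0//.
by rewrite uv lerDl sqr_ge0.
Qed.

Lemma ip_neq0 u : u != 0 -> << u, u >> != 0.
Proof. by move=> u0; rewrite nm_sqr cr_eq0 sqrf_eq0 gt_eqF// nm_gt0. Qed.

(** The gain from removing the component along [u]; it yields both Cauchy-Schwarz and the
    orthogonality of a minimizer. *)
Lemma nm_sub_proj u v : u != 0 ->
  nm (v - << u, v >> / << u, u >> *: u) ^+ 2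
    = nm v ^+ 2 - (nc << u, v >> / nm u) ^+ 2.
Proof.
move=> /ip_neq0 u0; apply: crI.
rewrite -nm_sqr crD crN expr_div_n (crM (nc _ ^+ 2)) nc_sqr -nm_sqr crV -nm_sqr.
rewrite ?(ipDl, ipNl, ipZl, ipDr, ipNr, ipZr) cjM cjV -(ipC u u) -(ipC u v).
by field.
Qed.

Lemma CauchySchwarz_nm u v : nc << u, v >> <= nm u * nm v.
Proof.
have [->|u0] := eqVneq u 0; first by rewrite ip0l nc0 nm0 mul0r.
have nu : 0 < nm u by rewrite nm_gt0.
rewrite mulrC -ler_pdivrMr// -(@ler_pXn2r _ 2) ?nnegrE ?divr_ge0 ?nm_ge0 ?nc_ge0//.
by rewrite -subr_ge0 -nm_sub_proj// sqr_ge0.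
Qed.

(** The projection theorem for a subspace that may not be closed: near-minimizers of the distance
    from [v] to [M] converge to some [p], the residual [v - p] is orthogonal to [M], hence zero, and
    so [M] comes arbitrarily close to [v]. *)
Lemma dense_orth (M : set H) :
  M 0 -> (forall a u v, M u -> M v -> M (a *: u + v)) ->
  (forall u, (forall m, M m -> << m, u >> = 0) -> u = 0) -> dense M.
Proof.
move=> M0 ML Mo; apply/dense_nm => v e e0.
pose X := [set nm (v - m) | m in M]; pose D := inf X.
have X0 : lbound X 0 by move=> _ [m _ <-]; exact: nm_ge0.
have hX : has_inf X by split; [exists (nm (v - 0)), 0|exists 0].
have DX m : M m -> D <= nm (v - m).
  by move=> Mm; apply: ge_inf; [exists 0|exists m].
have D0 : 0 <= D by apply: lb_le_inf => //; case: hX.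
pose S (d : R) := [set m | M m /\ nm (v - m) < D + d].
(* Parallelogram law: the midpoint of [m] and [m'] is in [M], hence at distance at least [D] from
   [v], so near-minimizers are close to each other. *)
have half m m' : M m -> M m' ->
    nm (m - m') ^+ 2 <= 2 * nm (v - m) ^+ 2 + 2 * nm (v - m') ^+ 2 - 4 * D ^+ 2.
  move=> Mm Mm'; have := parallelogram (v - m) (v - m').
  have -> : v - m - (v - m') = m' - m by vect.
  have Mh : M (2^-1 *: (m + m')).
    have Ms : M (m + m') by rewrite -[m]scale1r; exact: ML.
    by rewrite -[_ *: _]addr0; exact: ML.
  have -> : v - m + (v - m') = 2 *: (v - 2^-1 *: (m + m')).
    by apply: ip_inj => w; rewrite ?(ipDr, ipNr, ipZr, ip0r); field.
  rewrite nmZ (nmBC m' m).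
  have -> : nc (2 : R[i]) = 2.
    by apply: crI; rewrite -ncE normr_nat; symmetry; exact: rmorph_nat.
  have := DX _ Mh; set h := nm (v - _ *: _) => Dh.
  have : D ^+ 2 <= h ^+ 2 by rewrite ler_pXn2r// nnegrE nm_ge0.
  by rewrite exprMn; lra.
have [||r r0|p near_p] := @shrinking_limit _ _ S.
- by move=> d d0; have [_ [m Mm <-] mD] := inf_adherent d0 hX; exists m.
- move=> d d' dd' m [Mm md]; split => //; apply: lt_le_trans md _.
  by rewrite lerD2l.
(* By [half], the squared distance of two points of [S d] is below [4 (D + d)^2 - 4 D^2], which for
   [d <= 1] is at most [4 d (2 D + 1)], hence at most [r^2]. *)
- pose d := Num.min 1 (r ^+ 2 / (8 * D + 8)).
  have d0 : 0 < d by rewrite lt_min ltr01 divr_gt0 ?exprn_gt0//; lra.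
  exists d => // m m' [Mm md] [Mm' m'd].
  rewrite -(@ltr_pXn2r _ 2)// ?nnegrE ?nm_ge0 ?(ltW r0)//.
  apply: le_lt_trans (half _ _ Mm Mm') _.
  have d1 : d <= 1 by rewrite ge_min lexx.
  have dr : d * (8 * D + 8) <= r ^+ 2.
    by rewrite -ler_pdivlMr; [rewrite ge_min lexx orbT|lra].
  have h1 : nm (v - m) ^+ 2 < (D + d) ^+ 2.
    by rewrite ltr_pXn2r// nnegrE ?nm_ge0// addr_ge0// ltW.
  have h2 : nm (v - m') ^+ 2 < (D + d) ^+ 2.
    by rewrite ltr_pXn2r// nnegrE ?nm_ge0// addr_ge0// ltW.
  have : (D + d) ^+ 2 - D ^+ 2 <= d * (2 * D + 1).
    have : d * d <= d by rewrite ger_pMl.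
    by rewrite !expr2 => ?; lra.
  by nra.
have qD : nm (v - p) <= D.
  apply/ler_addgt0Pr => d d0; have [|m [Mm vm] mp] := near_p (d / 2); first by lra.
  have -> : v - p = (v - m) + (m - p) by rewrite addrA subrK.
  by have := nmD (v - m) (m - p); lra.
(* Minimality passes from the points of [M] near [p] to [p] itself, which may lie outside [M]. *)
have Dq a m : M m -> D <= nm (v - p - a *: m).
  move=> Mm; apply/ler_addgt0Pr => d d0; have [m' [Mm' vm] mp] := near_p d d0.
  have -> : v - p - a *: m = (v - (a *: m + m')) - (p - m') by vect.
  have := DX _ (ML a _ _ Mm Mm'); rewrite nmBC in mp.
  have : nm (v - (a *: m + m')) <= nm (v - (a *: m + m') - (p - m')) + nm (p - m').
    by rewrite -[leLHS]/(nm _) -[X in nm X <= _](subrK (p - m')); exact: nmD.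
  by lra.
(* Removing the component along [m] cannot shorten [v - p], so this component is zero. *)
have q0 : v - p = 0.
  apply: Mo => m Mm; have [->|m0] := eqVneq m 0; first by rewrite ip0l.
  have := Dq (<< m, v - p >> / << m, m >>) m Mm.
  move: (v - p) qD => q qD Da.
  have : nm q ^+ 2 <= nm (q - << m, q >> / << m, m >> *: m) ^+ 2.
    by rewrite ler_pXn2r// ?nnegrE ?nm_ge0// (le_trans qD).
  rewrite nm_sub_proj//.
  rewrite lerBrDl gerDr => h; have : nc << m, q >> / nm m = 0.
    by apply/eqP; rewrite -sqrf_eq0 eq_le h sqr_ge0.
  move/eqP; rewrite mulf_eq0 invr_eq0 => /orP[/eqP h0|]; last first.
    by rewrite gt_eqF// nm_gt0.
  by apply/eqP; apply: contraT; rewrite -nc_gt0 h0 ltxx.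
have [m [Mm _] mp] := near_p e e0; exists m => //.
by have /eqP := q0; rewrite subr_eq0 => /eqP ->.
Qed.

(** If the least bound [b] of [B] on [V] exceeded [b0], then [b - B] and [b + B], hence their
    product, would be bounded below on [V], and [b] could be lowered. [V] will be the whole space
    for the spectral gap, and the orthogonal of all eigenvectors for totality; [M] makes the set of
    bounds nonempty. *)
Lemma symmetric_norm_le (B : H -> H) (V : set H) (b0 M : R) :
  (forall a u v, B (a *: u + v) = a *: B u + B v) ->
  (forall a u v, V u -> V v -> V (a *: u + v)) ->
  (forall u, V u -> V (B u)) ->
  (forall u v, << B u, v >> = << u, B v >>) ->
  (forall u, V u -> nm (B u) <= M * nm u) ->
  0 <= b0 ->
  (forall b, b0 < b -> exists c : R, [/\ 0 < c,
     forall u, V u -> c * nm u <= nm (cr b *: u - B u) &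
     forall u, V u -> c * nm u <= nm (cr b *: u + B u)]) ->
  forall u, V u -> nm (B u) <= b0 * nm u.
Proof.
move=> Bl Vl BV Bs BM b00 Bb u0 Vu0; rewrite leNgt; apply/negP => u0b.
have B0 : B 0 = 0 by have := Bl (-1) 0 0; rewrite !scaleN1r !addNr.
pose X := [set b : R | 0 <= b /\ forall u, V u -> nm (B u) <= b * nm u].
have X0 : lbound X 0 by move=> b [].
have hX : has_inf X.
  split; last by exists 0.
  exists `|M|; split => // u /BM/le_trans; apply.
  by rewrite ler_wpM2r ?nm_ge0// ler_norm.
pose b := inf X; have Xb : X b.
  split; first by apply: lb_le_inf => //; case: hX.
  move=> u Vu; have [->|un0] := eqVneq u 0; first by rewrite B0 !nm0 mulr0.
  rewrite -ler_pdivrMr ?nm_gt0//; apply: lb_le_inf; first by case: hX.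
  by move=> d [_ dB]; rewrite ler_pdivrMr ?nm_gt0// dB.
have [b_ge0 bB] := Xb.
have bb0 : b0 < b.
  rewrite ltNge; apply/negP => bb0; move: u0b; apply/negP; rewrite -leNgt.
  by apply: le_trans (bB _ Vu0) _; rewrite ler_wpM2r ?nm_ge0.
have b_gt0 : 0 < b by exact: le_lt_trans bb0.
have [c [c0 cm cp]] := Bb _ bb0.
have low u : V u -> c ^+ 2 * nm u <= nm (cr (b ^+ 2) *: u - B (B u)).
  move=> Vu; have Vp : V (cr b *: u + B u) by apply: (Vl) => //; exact: BV.
  have -> : cr (b ^+ 2) *: u - B (B u)
      = cr b *: (cr b *: u + B u) - B (cr b *: u + B u).
    by rewrite Bl crX; vect.
  apply: le_trans (cm _ Vp).
  by rewrite expr2 -mulrA ler_pM2l// cp.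
(* [|(b^2 - B^2) u|^2 <= b^2 (b^2 |u|^2 - |B u|^2)], while [b^2 - B^2] is
   bounded below: [b] is not the norm of [B]. *)
have sq u : V u -> nm (B u) ^+ 2 <= (b ^+ 2 - c ^+ 4 / b ^+ 2) * nm u ^+ 2.
  move=> Vu; have : (c ^+ 2 * nm u) ^+ 2 <= nm (cr (b ^+ 2) *: u - B (B u)) ^+ 2.
    by rewrite sqr_le ?low ?nm_ge0// mulr_ge0 ?nm_ge0 ?sqr_ge0.
  have -> : nm (cr (b ^+ 2) *: u - B (B u)) ^+ 2 =
      b ^+ 4 * nm u ^+ 2 + nm (B (B u)) ^+ 2 - 2 * b ^+ 2 * nm (B u) ^+ 2.
    rewrite nmB2 nmZ nc_cr ger0_norm ?sqr_ge0// ipZl cj_cr -Bs nm_sqr Re_crM Re_cr.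
    by ring.
  have : nm (B (B u)) ^+ 2 <= (b * nm (B u)) ^+ 2.
    by rewrite sqr_le ?nm_ge0 ?mulr_ge0 ?nm_ge0//; apply: (bB); exact: BV.
  have -> : (b * nm (B u)) ^+ 2 = b ^+ 2 * nm (B u) ^+ 2 by ring.
  have -> : (c ^+ 2 * nm u) ^+ 2 = c ^+ 4 * nm u ^+ 2 by ring.
  move=> h1 h2.
  have -> : (b ^+ 2 - c ^+ 4 / b ^+ 2) * nm u ^+ 2 =
      (b ^+ 4 * nm u ^+ 2 - c ^+ 4 * nm u ^+ 2) / b ^+ 2.
    by field; rewrite gt_eqF.
  by rewrite ler_pdivlMr ?exprn_gt0//; lra.
(* The second entry gives [2 b d <= c^4 / b^2], so that [(b - d)^2] still dominates the factor in
   [sq]; the first keeps [b - d] nonnegative. *)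
pose d := Num.min b (c ^+ 4 / (2 * b ^+ 3)).
have d0 : 0 < d by rewrite lt_min b_gt0 divr_gt0 ?mulr_gt0 ?exprn_gt0.
have db : d <= b by rewrite ge_min lexx.
suff Xd : X (b - d) by have := @ge_inf _ X (ex_intro _ 0 X0) _ Xd; rewrite -/b; lra.
have bd0 : 0 <= b - d by lra.
split=> // u Vu.
rewrite -sqr_le ?nm_ge0 ?mulr_ge0 ?nm_ge0//.
apply: le_trans (sq _ Vu) _; rewrite exprMn ler_wpM2r ?sqr_ge0//.
have dc : d * (2 * b) <= c ^+ 4 / b ^+ 2.
  have -> : c ^+ 4 / b ^+ 2 = c ^+ 4 / (2 * b ^+ 3) * (2 * b).
    by field; rewrite gt_eqF.
  by rewrite ler_pM2r ?mulr_gt0// ge_min lexx orbT.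
have : 0 <= d ^+ 2 by exact: sqr_ge0.
by rewrite sqrrB; lra.
Qed.

(** A point of [M] closer to [u] than [nm u] would contradict Pythagoras, being orthogonal to
    [u]. *)
Lemma dense_ip0 (M : set H) u :
  dense M -> (forall m, M m -> << m, u >> = 0) -> u = 0.
Proof.
move=> /dense_nm dM Mu; apply: nm0_eq0; rewrite leNgt; apply/negP => u0.
have [m Mm mu] := dM u (nm u) u0.
have := pythagoras (Mu m Mm : << m, u >> = 0).
have -> : nm (m + u) ^+ 2 = nm (m - u) ^+ 2.
  by rewrite nmB2 nmD2 Mu//=; ring.
have : nm (m - u) ^+ 2 < nm u ^+ 2.
  by rewrite ltr_pXn2r// nnegrE nm_ge0.
by have := sqr_ge0 (nm m); lra.
Qed.

(** * Resolvents, and the range of a self-adjoint operator *)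

Section OneOperator.
Variable T : operator H.
Local Notation D := (op_dom T).

Lemma op_domZ a u : D u -> D (a *: u).
Proof. by move=> Du; rewrite -[_ *: _]addr0; apply: op_domP => //; exact: op_dom0. Qed.

Lemma op_domD u v : D u -> D v -> D (u + v).
Proof. by move=> Du Dv; rewrite -[u]scale1r; exact: op_domP. Qed.

Lemma op_domN u : D u -> D (- u).
Proof. by rewrite -scaleN1r; exact: op_domZ. Qed.

Lemma op_domB u v : D u -> D v -> D (u - v).
Proof. by move=> Du /op_domN; exact: op_domD. Qed.

Lemma op_at0 : T 0 = 0.
Proof.
have := @op_linear _ _ T (-1) 0 0 (op_dom0 T) (op_dom0 T).
by rewrite !scaleN1r !addNr.
Qed.

Lemma opZ a u : D u -> T (a *: u) = a *: T u.
Proof.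
move=> Du; have := @op_linear _ _ T a u 0 Du (op_dom0 T).
by rewrite op_at0 !addr0.
Qed.

Lemma opD u v : D u -> D v -> T (u + v) = T u + T v.
Proof.
by move=> Du Dv; have := @op_linear _ _ T 1 u v Du Dv; rewrite !scale1r.
Qed.

Lemma opN u : D u -> T (- u) = - T u.
Proof. by move=> Du; rewrite -scaleN1r opZ// scaleN1r. Qed.

Lemma opB u v : D u -> D v -> T (u - v) = T u - T v.
Proof. by move=> Du Dv; rewrite opD ?opN//; exact: op_domN. Qed.

Lemma resolvent_bounded_below z : resolvent_set T z ->
  exists2 c : R, 0 < c & forall v, D v -> c * nm v <= nm (T v - z *: v).
Proof.
move=> [B [Bc Br Bl]].
have B0 : B 0 = 0.
  by have := Bl 0 (op_dom0 T); rewrite op_at0 scaler0 subr0.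
have [d d0 dB] : exists2 d : R, 0 < d & forall u, nm u < d -> nm (B u) < 1.
  have : nbhs (B 0) [set u | nm (u - B 0) < 1].
    by apply/nbhs_nm; exists 1.
  move=> /Bc /nbhs_nm[d d0 dB]; exists d => // u ud.
  by have := dB u; rewrite /= B0 !subr0; exact.
exists (d / 2); first by lra.
move=> v Dv; have [w0|w0] := eqVneq (T v - z *: v) 0.
  by have := Bl v Dv; rewrite w0 B0 => <-; rewrite !nm0 mulr0.
have nw : 0 < nm (T v - z *: v) by rewrite nm_gt0.
(* Rescales [T v - z v] to norm [d / 2], inside the ball that [B] maps into the unit ball. *)
pose a := d / 2 / nm (T v - z *: v).
have a0 : 0 < a by rewrite /a !divr_gt0.
have := dB (cr a *: (T v - z *: v)).
have <- : T (cr a *: v) - z *: (cr a *: v) = cr a *: (T v - z *: v).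
  by rewrite opZ//; vect.
rewrite Bl; last exact: op_domZ.
rewrite opZ// scalerA mulrC -scalerA -scalerBr !nmZ nc_cr gtr0_norm//.
have -> : a * nm (T v - z *: v) = d / 2 by rewrite /a divfK// gt_eqF.
move=> /(_ _)/ltW; rewrite ltr_pdivrMr// ltr_pMr// ltr1n => /(_ isT).
by rewrite /a mulrAC ler_pdivrMr// mul1r.
Qed.

Lemma resolventP z u : resolvent_set T z ->
  D (resolvent T z u) /\ T (resolvent T z u) - z *: resolvent T z u = u.
Proof.
move=> [B [_ Br _]]; rewrite /resolvent.
by case: xgetP => [v _ //|/(_ (B u))[]]; exact: Br.
Qed.

Lemma resolvent_uniq z u v : resolvent_set T z ->
  D v -> T v - z *: v = u -> v = resolvent T z u.
Proof.
move=> rz Dv vu; have [Dw wu] := resolventP u rz.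
move: rz => [B [_ _ Bl]].
by rewrite -(Bl _ Dv) -(Bl _ Dw) vu wu.
Qed.

Lemma resolvent_linear z : resolvent_set T z -> forall a u v,
  resolvent T z (a *: u + v) = a *: resolvent T z u + resolvent T z v.
Proof.
move=> rz a u v; symmetry; have [Du ru] := resolventP u rz.
have [Dv rv] := resolventP v rz.
apply: resolvent_uniq => //; first exact: op_domP.
by rewrite op_linear// -[in RHS]ru -[in RHS]rv; vect.
Qed.

Lemma resolvent_nm_le z : resolvent_set T z ->
  exists2 M : R, 0 < M & forall u, nm (resolvent T z u) <= M * nm u.
Proof.
move=> rz; have [c c0 cT] := resolvent_bounded_below rz.
exists c^-1; first by rewrite invr_gt0.
move=> u; have [Du ru] := resolventP u rz.
by rewrite mulrC ler_pdivlMr// mulrC -[in leRHS]ru cT.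
Qed.

Hypothesis T_sa : self_adjoint dot T.

Lemma sa_sym u v : D u -> D v -> << T u, v >> = << u, T v >>.
Proof.
move=> Du Dv; have [_ /(_ u (T u))[h _]] := T_sa.
exact: (h (conj Du erefl)).
Qed.

Lemma sa_adjoint v w :
  (forall u, D u -> << w, u >> = << v, T u >>) -> D v /\ T v = w.
Proof. by have [_ /(_ v w)[_ h]] := T_sa. Qed.

Lemma eigenvalue_real z v : D v -> T v = z *: v -> v != 0 -> cj z = z.
Proof.
move=> Dv Tv v0; have := sa_sym Dv Dv; rewrite Tv ipZl ipZr.
by move/(mulIf (ip_neq0 v0)).
Qed.

(** Closed range: the lower bound makes approximate solutions Cauchy, and their limit [p] lies in
    the domain because [T] equals its adjoint, which is tested by weak identities. *)
Lemma sa_closed (c : R) z (u : H) : 0 < c ->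
  (forall v, D v -> c * nm v <= nm (T v - z *: v)) ->
  (forall e : R, 0 < e -> exists2 v, D v & nm (T v - z *: v - u) < e) ->
  exists2 v, D v & T v - z *: v = u.
Proof.
move=> c0 cT app.
pose S (e : R) := [set v | D v /\ nm (T v - z *: v - u) < e].
have [||e e0|p Sp] := @shrinking_limit _ _ S.
- by move=> e e0; have [v Dv ve] := app e e0; exists v.
- by move=> e e' ee' v [Dv ve]; split => //; exact: lt_le_trans ee'.
- exists (c * e / 2); first by rewrite divr_gt0 ?mulr_gt0.
  move=> v w [Dv ve] [Dw we].
  have := cT _ (op_domB Dv Dw); rewrite opB//.
  have -> : T v - T w - z *: (v - w) = (T v - z *: v - u) - (T w - z *: w - u).
    by vect.
  move=> h; have := nmB (T v - z *: v - u) (T w - z *: w - u).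
  by rewrite -(ltr_pM2l c0); lra.
have [Dp Tp] : D p /\ T p = u + z *: p; last first.
  by exists p => //; rewrite Tp addrK.
apply: sa_adjoint => x Dx; apply/eqP; rewrite -subr_eq0; apply/eqP.
set y := _ - _; suff : nc y <= 0.
  by move=> y0; apply/eqP; apply: contraT; rewrite -nc_gt0 ltNge y0.
(* Collects the factors of the error [e] in the three Cauchy-Schwarz bounds below. *)
pose K := (1 + nc z) * nm x + nm (T x).
have K0 : 0 <= K by rewrite addr_ge0 ?mulr_ge0 ?addr_ge0 ?nc_ge0 ?nm_ge0.
apply/ler_addgt0Pr => d d0; rewrite add0r.
pose e := d / (K + 1).
have e0 : 0 < e by rewrite divr_gt0//; lra.
have [w [Dw we] wp] := Sp _ e0.
have -> : y = << z *: (p - w), x >> - << T w - z *: w - u, x >> - << p - w, T x >>.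
  rewrite /y ?(ipDl, ipNl, ipZl) (sa_sym Dw Dx); ring.
have h1 := CauchySchwarz_nm (z *: (p - w)) x.
have h2 := CauchySchwarz_nm (T w - z *: w - u) x.
have h3 := CauchySchwarz_nm (p - w) (T x).
rewrite nmZ in h1; rewrite nmBC in wp.
set y1 := << _, _ >> in h1 *; set y2 := << _, _ >> in h2 *.
set y3 := << _, _ >> in h3 *.
have h4 : nc (y1 - y2 - y3) <= nc y1 + nc y2 + nc y3.
  have := ncD (y1 - y2) (- y3); have := ncD y1 (- y2); rewrite !ncN; lra.
have : nc z * nm (p - w) * nm x <= nc z * e * nm x.
  by rewrite ler_wpM2r ?nm_ge0// ler_wpM2l ?nc_ge0// ltW.
have : nm (T w - z *: w - u) * nm x <= e * nm x by rewrite ler_wpM2r ?nm_ge0// ltW.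
have : nm (p - w) * nm (T x) <= e * nm (T x) by rewrite ler_wpM2r ?nm_ge0// ltW.
have eK : e * (K + 1) = d by rewrite /e divfK// gt_eqF//; lra.
rewrite /K in eK; lra.
Qed.

(** The range of [T - z] is closed by [sa_closed]. It is dense, since a nonzero vector orthogonal to
    it would be an eigenvector for [cj z]; then [z] would be real and the lower bound violated. *)
Lemma resolvent_crit (c : R) z : 0 < c ->
  (forall v, D v -> c * nm v <= nm (T v - z *: v)) -> resolvent_set T z.
Proof.
move=> c0 cT; pose M := [set T v - z *: v | v in D].
have inj v w : D v -> D w -> T v - z *: v = T w - z *: w -> v = w.
  move=> Dv Dw vw; apply/eqP; rewrite -subr_eq0; apply/eqP/nm0_eq0.
  rewrite -(@ler_pM2l _ c)// mulr0 (le_trans (cT _ (op_domB Dv Dw)))//.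
  rewrite opB// (_ : _ - _ = (T v - z *: v) - (T w - z *: w)); last by vect.
  by rewrite vw subrr nm0.
have dM : dense M.
  apply: dense_orth.
  - by exists 0; [exact: op_dom0|rewrite op_at0 scaler0 subr0].
  - move=> a _ _ [u Du <-] [v Dv <-]; exists (a *: u + v); first exact: op_domP.
    by rewrite op_linear//; vect.
  move=> u Mu; have [Du Tu] : D u /\ T u = cj z *: u.
    apply: sa_adjoint => x Dx; rewrite ipZl cjK.
    have /ip_eq0C : << T x - z *: x, u >> = 0 by apply: Mu; exists x.
    by rewrite !ipE => /eqP; rewrite subr_eq0 => /eqP.
  apply/eqP; apply: contraT => u0.
  have zr : cj z = z.
    by have := eigenvalue_real Du Tu u0; rewrite cjK.
  have := cT _ Du; rewrite Tu zr subrr nm0.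
  by rewrite leNgt mulr_gt0// nm_gt0.
have surj u : exists v, D v /\ T v - z *: v = u.
  have [|v Dv vu] := sa_closed c0 cT (u := u); last by exists v.
  move=> e e0; have /dense_nm := dM => /(_ u e e0)[_ [v Dv <-] vu].
  by exists v.
pose B u := xget 0 [set v | D v /\ T v - z *: v = u].
have BP u : D (B u) /\ T (B u) - z *: B u = u.
  by rewrite /B; case: xgetP => [//|] h; have [v] := surj u; move/h.
exists B; split => //.
  move=> u; apply/cvg_nm => e e0.
  have : nbhs u [set v | nm (v - u) < c * e].
    by apply/nbhs_nm; exists (c * e) => //; rewrite mulr_gt0.
  apply: filterS => v /= vu; have [Du uE] := BP u; have [Dv vE] := BP v.
  rewrite -(ltr_pM2l c0); apply: le_lt_trans vu.
  apply: le_trans (cT _ (op_domB Dv Du)) _.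
  rewrite opB// -[in leRHS]vE -[in leRHS]uE le_eqVlt; apply/orP; left; apply/eqP.
  by congr nm; vect.
by move=> v Dv; have [Dw wE] := BP (T v - z *: v); exact: inj.
Qed.

End OneOperator.

(** Used with [p] the value at [u] of an inverse operator: a lower bound at [p] for a shift of the
    original operator becomes one at [u] for [b] minus or plus the inverse, through
    [b |u| <= |b u - s p| + |p|]. *)
Lemma absorb_le (b k s : R) u p : 0 < b -> 0 < k -> `|s| = 1 ->
  k * nm p <= nm (cr b^-1 *: (cr b *: u - cr s *: p)) ->
  b / (1 + 1 / (b * k)) * nm u <= nm (cr b *: u - cr s *: p).
Proof.
move=> b0 k0 s1; rewrite nmZ nc_cr gtr0_norm ?invr_gt0// ler_pdivlMl// => h.
rewrite mulrAC ler_pdivrMr; last by rewrite ltr_wpDr// divr_ge0// mulr_ge0// ltW.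
have := nmD (cr b *: u - cr s *: p) (cr s *: p).
rewrite subrK !nmZ !nc_cr s1 mul1r (gtr0_norm b0).
move: (nm (_ - _)) h => X h; rewrite mulrDr mulr1 mul1r mulrC.
have : nm p <= X / (b * k) by rewrite ler_pdivlMr ?mulr_gt0// mulrC -mulrA.
by lra.
Qed.

(** * Self-adjoint operators: spectral gaps and totality of eigenvectors *)

Section SelfAdjoint.
Variable T : operator H.
Hypothesis T_sa : self_adjoint dot T.
Local Notation D := (op_dom T).

Lemma resolvent_sym (x : R) u v : resolvent_set T (cr x) ->
  << resolvent T (cr x) u, v >> = << u, resolvent T (cr x) v >>.
Proof.
move=> rx; have [Du uE] := resolventP u rx; have [Dv vE] := resolventP v rx.
rewrite -[in LHS]vE -[in RHS]uE ipDr ipNr ipZr ipDl ipNl ipZl cj_cr.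
by rewrite (sa_sym T_sa Du Dv).
Qed.

Lemma resolvent_comm (z w : R[i]) u : resolvent_set T z -> resolvent_set T w ->
  resolvent T z (resolvent T w u) = resolvent T w (resolvent T z u).
Proof.
move=> rz rw; set q := resolvent T w u; set p := resolvent T z q.
have [Dq qE] := resolventP u rw; rewrite -/q in Dq qE.
have [Dp pE] := resolventP q rz; rewrite -/p in Dp pE.
have TpE : T p = q + z *: p by rewrite -pE subrK.
have DTp : D (T p) by rewrite TpE; apply: op_domD => //; exact: op_domZ.
apply: resolvent_uniq => //; apply: resolvent_uniq => //.
  by apply: op_domB => //; exact: op_domZ.
rewrite opB//; last exact: op_domZ.
rewrite opZ// [T (T p)](_ : _ = T q + z *: T p); last first.
  by rewrite {1}TpE opD ?opZ//; exact: op_domZ.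
by rewrite -[RHS]qE TpE; vect.
Qed.

(** * The gap around an isolated simple eigenvalue *)

Section Gap.
Variables (l r : R) (e : H).
Hypothesis r_gt0 : 0 < r.
Hypothesis l_isolated : forall z : R[i], z != cr l -> nc (z - cr l) < r ->
  resolvent_set T z.
Hypothesis De : D e.
Hypothesis Te : T e = cr l *: e.
Hypothesis e_neq0 : e != 0.
Hypothesis e_simple : forall v, D v -> T v = cr l *: v -> exists c, v = c *: e.

Let S v := T v - cr l *: v.

Let near_l (s : R) : s != 0 -> `|s| < r -> resolvent_set T (cr (l + s)).
Proof.
move=> s0 sr; apply: l_isolated.
  by rewrite crD -subr_eq0 addrAC subrr add0r cr_eq0.
by rewrite crD addrAC subrr add0r nc_cr.
Qed.

(** [S^2 - a^2] is the product of [S - a] and [S + a], both bounded below as [l + a] and [l - a] are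
    in the resolvent set. *)
Let square_bounded_below (a : R) : 0 < a -> a < r ->
  exists2 k : R, 0 < k &
    forall p, D p -> D (T p) -> k * nm p <= nm (S (S p) - cr (a ^+ 2) *: p).
Proof.
move=> a0 ar.
have [|c1 c10 h1] := @resolvent_bounded_below T (cr (l + a)).
  by apply: near_l; [rewrite gt_eqF|rewrite gtr0_norm].
have [|c2 c20 h2] := @resolvent_bounded_below T (cr (l + - a)).
  by apply: near_l; [rewrite oppr_eq0 gt_eqF|rewrite normrN gtr0_norm].
exists (c1 * c2); first by rewrite mulr_gt0.
move=> p Dp DTp; pose g := T p - cr (l + - a) *: p.
have Dg : D g by apply: op_domB => //; exact: op_domZ.
rewrite -mulrA; apply: (@le_trans _ _ (c1 * nm g)).
  by rewrite ler_pM2l// h2.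
apply: le_trans (h1 _ Dg) _; rewrite le_eqVlt; apply/orP; left; apply/eqP.
congr nm; rewrite /S /g !opB ?opZ//; try exact: op_domZ.
by rewrite !crE; vect.
Qed.

Let t := r / 2.
Let t_gt0 : 0 < t. Proof. by rewrite divr_gt0. Qed.
Let t_lt : t < r. Proof. by rewrite /t ltr_pdivrMr// ltr_pMr// ltr1n. Qed.
Let rp : resolvent_set T (cr (l + t)).
Proof. by apply: near_l; [rewrite gt_eqF|rewrite gtr0_norm]. Qed.
Let rm : resolvent_set T (cr (l - t)).
Proof. by apply: near_l; [rewrite oppr_eq0 gt_eqF|rewrite normrN gtr0_norm]. Qed.

Let B := resolvent T (cr (l + t)).
(* [C = (S^2 - t^2)^-1]; as [t = r / 2], the gap of [S] at [0] bounds it by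
   [t^-2]. *)
Let C u := B (resolvent T (cr (l - t)) u).

Let CP u : [/\ D (C u), D (T (C u)) & S (S (C u)) - cr (t ^+ 2) *: C u = u].
Proof.
set q := resolvent T (cr (l - t)) u.
have [Dq qE] := resolventP u rm; rewrite -/q in Dq qE.
have [Dp pE] := resolventP q rp; rewrite -/B -/(C u) in Dp pE.
have TpE : T (C u) = q + cr (l + t) *: C u by rewrite -pE subrK.
have DTp : D (T (C u)) by rewrite TpE; apply: op_domD => //; exact: op_domZ.
split => //; rewrite -[RHS]qE -pE /S !opB ?opZ//; try exact: op_domZ.
by rewrite !crE; vect.
Qed.

Let CE p : D p -> D (T p) -> C (S (S p) - cr (t ^+ 2) *: p) = p.
Proof.
move=> Dp DTp; symmetry; apply: resolvent_uniq => //.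
have Dq : D (T p - cr (l + t) *: p) by apply: op_domB => //; exact: op_domZ.
apply: resolvent_uniq => //; rewrite /S !opB ?opZ//; try exact: op_domZ.
by rewrite !crE; vect.
Qed.

(** With [p = C u], [(S^2 - y^2) p = u - (s / b) p], so the lower bound on [S^2 - y^2] carries over
    to [b - s C]. *)
Let C_bounded_below (b : R) (y : R) (s : R) :
  t ^- 2 < b -> `|s| = 1 -> 0 < y -> y < r -> y ^+ 2 = t ^+ 2 + s / b ->
  exists2 c : R, 0 < c & forall u, c * nm u <= nm (cr b *: u - cr s *: C u).
Proof.
move=> tb s1 y0 yr yE; have b0 : 0 < b by apply: lt_trans tb; rewrite invr_gt0 exprn_gt0.
have [k k0 kP] := square_bounded_below y0 yr.
exists (b / (1 + 1 / (b * k))); first by rewrite divr_gt0// ltr_wpDr// divr_ge0// mulr_ge0// ltW.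
move=> u; have [Dp DTp uE] := CP u; have := kP _ Dp DTp.
have -> : S (S (C u)) - cr (y ^+ 2) *: C u = cr b^-1 *: (cr b *: u - cr s *: C u).
  move: (C u) uE => p <-; rewrite yE !crE.
  apply: ip_inj => w; rewrite ?(ipDr, ipNr, ipZr).
  by field; rewrite cr_eq0 gt_eqF.
by apply: absorb_le.
Qed.

(** For [b > t^-2], both [t^2 + 1/b] and [t^2 - 1/b] lie strictly between 0 and [2 t^2 < r^2]; their
    square roots serve as [y] in [C_bounded_below]. *)
Let C_norm u : nm (C u) <= t ^- 2 * nm u.
Proof.
have [M1 M10 M1P] := resolvent_nm_le rp.
have [M2 M20 M2P] := resolvent_nm_le rm.
have t2 : 0 < t ^- 2 by rewrite invr_gt0 exprn_gt0.
apply: (@symmetric_norm_le C setT _ (M1 * M2)) => //; last 2 first.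
- exact: ltW.
- move=> b tb; have b0 : 0 < b by exact: lt_trans tb.
  have bt : b^-1 < t ^+ 2 by rewrite invf_plt ?posrE ?exprn_gt0//; lra.
  have tr : t ^+ 2 + t ^+ 2 < r ^+ 2.
    have := exprn_gt0 2 r_gt0; rewrite /t; lra.
  have bi : 0 < b^-1 by rewrite invr_gt0.
  have [||||c1 c10 c1P] := @C_bounded_below b (Num.sqrt (t ^+ 2 + b^-1)) 1 tb.
  + by rewrite normr1.
  + by rewrite sqrtr_gt0 addr_gt0// exprn_gt0.
  + rewrite -(ltr_pXn2r (n := 2)) ?nnegrE ?sqrtr_ge0 ?(ltW r_gt0)// sqr_sqrtr; first by lra.
    by rewrite addr_ge0// ?sqr_ge0// ltW.
  + by rewrite sqr_sqrtr ?mul1r// addr_ge0// ?sqr_ge0// ltW.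
  have [||||c2 c20 c2P] := @C_bounded_below b (Num.sqrt (t ^+ 2 - b^-1)) (-1) tb.
  + by rewrite normrN normr1.
  + by rewrite sqrtr_gt0 subr_gt0.
  + rewrite -(ltr_pXn2r (n := 2)) ?nnegrE ?sqrtr_ge0 ?(ltW r_gt0)// sqr_sqrtr; first by lra.
    by rewrite subr_ge0 ltW.
  + by rewrite sqr_sqrtr ?mulN1r// subr_ge0 ltW.
  exists (Num.min c1 c2); split; first by rewrite lt_min c10.
    move=> v _; have := c1P v; rewrite scale1r; apply: le_trans.
    by rewrite ler_wpM2r ?nm_ge0// ge_min lexx.
  move=> v _; have := c2P v; rewrite crN scaleN1r opprK; apply: le_trans.
  by rewrite ler_wpM2r ?nm_ge0// ge_min lexx orbT.
- by move=> a u1 v1; rewrite /C /B !resolvent_linear.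
- by move=> u1 v1; rewrite /C /B !resolvent_sym// resolvent_comm.
- move=> u1 _; apply: le_trans (M1P _) _; rewrite -mulrA ler_pM2l//.
Qed.

(** Squaring the bound on [C] gives [t^4 |p|^2 <= |S^2 p|^2 - 2 t^2 |S p|^2 + t^4 |p|^2], where
    [t^4 |p|^2] cancels. Thus [S] is bounded below on its own range. *)
Let S_square p : D p -> D (T p) -> t * nm (S p) <= nm (S (S p)).
Proof.
move=> Dp DTp; have := C_norm (S (S p) - cr (t ^+ 2) *: p).
have t2 : 0 <= t ^+ 2 by exact: sqr_ge0.
rewrite CE// ler_pdivlMl ?exprn_gt0// -sqr_le; last 2 first.
- by apply: mulr_ge0 => //; exact: nm_ge0.
- exact: nm_ge0.
have DSp : D (S p) by apply: op_domB => //; exact: op_domZ.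
have SS : << S (S p), p >> = << S p, S p >>.
  have gE : S p = T p - cr l *: p by [].
  move: (S p) gE DSp => g gE Dg.
  rewrite /S ipDl ipNl ipZl cj_cr (sa_sym T_sa Dg Dp).
  by rewrite [X in _ = << _, X >>]gE ipDr ipNr ipZr.
rewrite nmB2 nmZ nc_cr ger0_norm ?sqr_ge0// ipZr SS nm_sqr Re_crM Re_cr => h.
rewrite -sqr_le; last 2 first.
- by apply: mulr_ge0; [exact: ltW|exact: nm_ge0].
- exact: nm_ge0.
have := mulr_ge0 (sqr_ge0 t) (sqr_ge0 (nm (S p))).
by rewrite !exprMn in h *; lra.
Qed.

(** An everywhere defined symmetric operator with the range of [S], to which orthogonality arguments
    apply without domain conditions. *)
Let Y x := S (B x).

Let YE x : Y x = x + cr t *: B x.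
Proof.
have [_] := resolventP x rp; rewrite -/(B x) /Y /S.
by move: (B x) => p <-; rewrite !crE; vect.
Qed.

Let e_orth v : D v -> << e, S v >> = 0.
Proof.
move=> Dv; rewrite /S ipDr ipNr ipZr -(sa_sym T_sa De Dv) Te ipZl cj_cr.
by rewrite subrr.
Qed.

(** [S_square] bounds [S] below on its range, which is dense in the orthogonal of [e]. To stay in
    the domain, the approximation is made at the level of [y], where [v = B y], rather than of
    [v]. *)
Lemma isolated_simple_gap v : D v -> << e, v >> = 0 ->
  r / 2 * nm v <= nm (T v - cr l *: v).
Proof.
move=> Dv ev; rewrite -/t -/(S v).
pose y := T v - cr (l + t) *: v.
have vE : v = B y by exact: resolvent_uniq.
have DB x : D (B x) by have [] := resolventP x rp.
have ey : << e, y >> = 0.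
  have := e_orth Dv; rewrite /y /S crD !(ipDr, ipNr, ipZr) ev !mulr0; exact.
have Blin a x x' : B (a *: x + x') = a *: B x + B x' by exact: resolvent_linear.
have B0 : B 0 = 0 by have := Blin (-1) 0 0; rewrite !scaleN1r !addNr.
pose M := [set m | exists x (c : R[i]), m = Y x + c *: e].
have dM : dense M.
  apply: dense_orth.
  - by exists 0, 0; rewrite YE B0 scaler0 scale0r !addr0.
  - move=> a _ _ [x [c ->]] [x' [c' ->]].
    by exists (a *: x + x'), (a * c + c'); rewrite !YE Blin; vect.
  (* A vector orthogonal to [M] is killed by the symmetric [Y], hence is a multiple of [e]; being
     orthogonal to [e], it vanishes. *)
  move=> u Mu.
  have eu : << e, u >> = 0.
    have := Mu e; apply; exists 0, 1.
    by rewrite YE B0 scaler0 scale1r !add0r.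
  have Yu : Y u = 0.
    apply: ip_inj => x; rewrite ip0r -(Mu (Y x)); last by exists x, 0; rewrite scale0r addr0.
    by rewrite !YE ipDr ipDl ipZr ipZl cj_cr resolvent_sym.
  have [|c Bu] := e_simple (DB u).
    by move/eqP: Yu; rewrite /Y /S subr_eq0 => /eqP.
  have [_ uE] := resolventP u rp; rewrite -/(B u) Bu opZ// Te in uE.
  have uE' : u = (- (cr t * c)) *: e by rewrite -uE crD; vect.
  move: eu; rewrite uE' ipZr => /eqP; rewrite mulf_eq0 (negPf (ip_neq0 e_neq0)) orbF.
  by move=> /eqP ->; rewrite scale0r.
have [K K0 KP] := resolvent_nm_le rp.
have tK : 0 < 1 + 2 * t * K by rewrite addr_gt0// !mulr_gt0.
(* The errors to absorb are [|dl|] once and [t |B dl|] twice, whence the factor [1 + 2 t K]. *)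
apply/ler_addgt0Pr => d d0; pose eps := d / (1 + 2 * t * K).
have eps0 : 0 < eps by rewrite divr_gt0.
have /dense_nm /(_ y eps eps0) [_ [x [c ->]] xc] := dM.
pose w := Y x; pose dl := w - y.
have ed : << e, dl >> = 0.
  by rewrite /dl ipDr ipNr ey subr0; exact: e_orth.
(* As [dl] is orthogonal to [e], dropping the multiple of [e] only brings the approximation closer
   to [y]. *)
have dle : nm dl <= eps.
  apply: ltW; apply: le_lt_trans xc.
  rewrite (_ : Y x + _ - y = dl + c *: e); last by rewrite /dl /w; vect.
  by apply: nm_le_orth; rewrite ipZr (ip_eq0C ed) mulr0.
(* [B w] is [S p] for [p = B (B x)], to which [S_square] applies. *)
have wS : t * nm (B w) <= nm (Y w).
  pose p := B (B x); have [Dp pE] := resolventP (B x) rp.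
  rewrite -/(B (B x)) -/p in Dp pE.
  have DTp : D (T p).
    rewrite -[T p](subrK (cr (l + t) *: p)) pE; apply: op_domD => //.
    exact: op_domZ.
  have SpE : S p = B w.
    rewrite -/(Y (B x)) /w !YE.
    by rewrite [x + _]addrC Blin addrC.
  by have := S_square Dp DTp; rewrite SpE.
have wE : w = y + dl by rewrite /dl; vect.
have Blin1 : B w = B y + B dl by rewrite wE -[y]scale1r Blin !scale1r.
have Yw : Y w = S v + (dl + cr t *: B dl).
  have -> : S v = y + cr t *: B y by rewrite -YE /Y -vE.
  by rewrite YE Blin1 wE; vect.
have h1 := nmD (S v) (dl + cr t *: B dl); rewrite -Yw in h1.
have h2 := nmD dl (cr t *: B dl); rewrite nmZ nc_cr (gtr0_norm t_gt0) in h2.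
have h3 : nm v <= nm (B w) + nm (B dl).
  by rewrite {1}vE (_ : B y = B w - B dl) ?nmB// Blin1; vect.
have h4 : nm (B dl) <= K * eps.
  by apply: le_trans (KP _) _; rewrite ler_pM2l.
have h5 : t * nm v <= t * (nm (B w) + nm (B dl)) by rewrite ler_pM2l.
have h6 : t * nm (B dl) <= t * (K * eps) by rewrite ler_pM2l.
have h7 : eps * (1 + 2 * t * K) = d by rewrite /eps divfK// gt_eqF.
by lra.
Qed.

End Gap.
(** A quantitative form of isolated and simple. For [A] it comes from the topological hypothesis;
    for [A_h] it is obtained directly. *)
Definition gapped_eigenvector z e :=
  [/\ e != 0, D e, T e = z *: e & exists2 c : R, 0 < c &
    forall v, D v -> << e, v >> = 0 -> c * nm v <= nm (T v - z *: v)].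

(** [T - w] respects the splitting along [e] and its orthogonal: it acts as [z - w] on the first and
    is bounded below by [c - |w - z|] on the second. *)
Lemma gapped_isolated z e : gapped_eigenvector z e ->
  exists2 c : R, 0 < c & forall w : R[i], w != z -> nc (w - z) < c -> resolvent_set T w.
Proof.
move=> [e0 De Te [c c0 ce]]; exists c => // w wz wc.
have zr := eigenvalue_real T_sa De Te e0.
have d0 : 0 < nc (w - z) by rewrite nc_gt0 subr_eq0.
pose k := Num.min (c - nc (w - z)) (nc (w - z)).
have k0 : 0 < k by rewrite lt_min d0 subr_gt0 wc.
apply: (resolvent_crit T_sa k0) => u Du.
pose a := << e, u >> / << e, e >>; pose v := u - a *: e.
have Dv : D v by apply: op_domB => //; exact: op_domZ.
have ev : << e, v >> = 0.
  by rewrite /v ipDr ipNr ipZr /a divfK ?subrr// ip_neq0.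
have uE : u = v + a *: e by rewrite /v subrK.
have eTv : << e, T v - w *: v >> = 0.
  by rewrite ipDr ipNr ipZr -(sa_sym T_sa De Dv) Te ipZl ev !mulr0 subr0.
have TuE : T u - w *: u = (T v - w *: v) + (z - w) *: (a *: e).
  by rewrite uE opD ?opZ ?Te//; [vect|exact: op_domZ].
rewrite -sqr_le; last 2 first.
- by apply: mulr_ge0; [exact: ltW|exact: nm_ge0].
- exact: nm_ge0.
rewrite TuE pythagoras; last first.
  by rewrite !ipZr (ip_eq0C eTv) !mulr0.
rewrite exprMn {1}uE pythagoras; last by rewrite ipZr (ip_eq0C ev) mulr0.
rewrite mulrDr -!exprMn lerD//.
  rewrite sqr_le ?nm_ge0 ?mulr_ge0 ?nm_ge0 ?(ltW k0)//.
  apply: (@le_trans _ _ ((c - nc (w - z)) * nm v)).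
    by rewrite ler_wpM2r ?nm_ge0// ge_min lexx.
  have := ce _ Dv ev.
  have := nmD (T v - w *: v) ((w - z) *: v); rewrite nmZ.
  have -> : T v - w *: v + (w - z) *: v = T v - z *: v by vect.
  by rewrite mulrBl; lra.
rewrite sqr_le ?nm_ge0 ?mulr_ge0 ?nm_ge0 ?(ltW k0)//.
by rewrite (nmZ (z - w)) -(ncN (z - w)) opprB ler_wpM2r ?nm_ge0// ge_min lexx orbT.
Qed.

(** On the orthogonal [V] of the eigenvectors, [T - y] is bounded below for every real [y], in the
    spectrum or not. Taking [y = x + 1/b] and [y = x - 1/b] for all [b > 0], [symmetric_norm_le]
    with [b0 = 0] makes the resolvent at [x] vanish on [V]. *)
Lemma eigenvectors_total :
  (forall z, spectrum T z -> exists e, gapped_eigenvector z e) ->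
  forall v, (forall z e, D e -> T e = z *: e -> << e, v >> = 0) -> v = 0.
Proof.
move=> gap.
(* The resolvent is symmetric at a real point: 0 itself, or a point next to it by isolation. *)
have [x rx] : exists x : R, resolvent_set T (cr x).
  have [r0|s0] := pselect (resolvent_set T 0); first by exists 0.
  have [e /gapped_isolated[c c0 ce]] := gap _ s0.
  exists (c / 2); apply: ce; first by rewrite cr_eq0 gt_eqF// divr_gt0.
  by rewrite subr0 nc_cr gtr0_norm ?divr_gt0//; lra.
pose V := [set v | forall z e, D e -> T e = z *: e -> << e, v >> = 0].
pose B := resolvent T (cr x).
have BV u : V u -> V (B u).
  move=> Vu z e De Te; have [Dp pE] := resolventP u rx; rewrite -/(B u) in Dp pE.
  have [->|e0] := eqVneq e 0; first exact: ip0l.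
  have := Vu _ _ De Te; move: (B u) Dp pE => p Dp <-.
  rewrite ipDr ipNr ipZr -(sa_sym T_sa De Dp) Te ipZl.
  rewrite (eigenvalue_real T_sa De Te e0) -mulrBl => /eqP; rewrite mulf_eq0.
  move=> /orP[|/eqP//]; rewrite subr_eq0 => /eqP zx; move: e0.
  have -> : e = 0.
    transitivity (B 0); first by apply: resolvent_uniq => //; rewrite Te zx subrr.
    symmetry; apply: resolvent_uniq => //; first exact: op_dom0.
    by rewrite op_at0 scaler0 subrr.
  by rewrite eqxx.
have low (b s : R) : 0 < b -> `|s| = 1 -> exists2 c : R, 0 < c &
    forall u, V u -> c * nm u <= nm (cr b *: u - cr s *: B u).
  move=> b0 s1; pose y := x + s / b.
  have [k k0 kP] : exists2 k : R, 0 < k &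
      forall p, V p -> D p -> k * nm p <= nm (T p - cr y *: p).
    have [ry|/gap[e [_ De Te [c c0 cP]]]] := pselect (resolvent_set T (cr y)).
      by have [c c0 cP] := resolvent_bounded_below ry; exists c => // p _; exact: cP.
    by exists c => // p Vp Dp; apply: cP => //; exact: Vp De Te.
  exists (b / (1 + 1 / (b * k))).
    by rewrite divr_gt0// ltr_wpDr// divr_ge0// mulr_ge0// ltW.
  move=> u Vu; apply: absorb_le => //.
  have [Dp pE] := resolventP u rx; rewrite -/(B u) in Dp pE.
  apply: le_trans (kP _ (BV _ Vu) Dp) _; rewrite le_eqVlt; apply/orP; left.
  apply/eqP; congr nm; move: (B u) pE => p <-; rewrite /y !crE.
  apply: ip_inj => w; rewrite ?(ipDr, ipNr, ipZr).
  by field; rewrite cr_eq0 gt_eqF.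
have [M M0 MP] := resolvent_nm_le rx.
have BV0 : forall u, V u -> nm (B u) <= 0 * nm u.
  apply: (@symmetric_norm_le B V 0 M) => //.
  - by move=> a u v; rewrite /B resolvent_linear.
  - by move=> a u v Vu Vv z e De Te; rewrite ipDr ipZr (Vu z)// (Vv z)// mulr0 addr0.
  - by move=> u v; rewrite /B resolvent_sym.
  move=> b b0; have [|c1 c10 c1P] := low b 1 b0; first exact: normr1.
  have [|c2 c20 c2P] := low b (-1) b0; first by rewrite normrN normr1.
  exists (Num.min c1 c2); split; first by rewrite lt_min c10.
    move=> v Vv; have := c1P v Vv; rewrite scale1r; apply: le_trans.
    by rewrite ler_wpM2r ?nm_ge0// ge_min lexx.
  move=> v Vv; have := c2P v Vv; rewrite crN scaleN1r opprK; apply: le_trans.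
  by rewrite ler_wpM2r ?nm_ge0// ge_min lexx orbT.
move=> v Vv; have [_ <-] := resolventP v rx; rewrite -/(B v).
have -> : B v = 0 by apply: nm0_eq0; have := BV0 v Vv; rewrite mul0r.
by rewrite op_at0 scaler0 subr0.
Qed.

End SelfAdjoint.

(** * The operator [A], its cyclic vector, and the vectors [xi] *)

Section CyclicOperator.
Variables (A : operator H) (mu : H).
Hypothesis A_sa : self_adjoint dot A.
Hypothesis A_discrete : discrete_simple_spectrum A.
Hypothesis mu_cyclic : cyclic A mu.
Hypothesis mu_norm : `|mu| = 1.
Local Notation D := (op_dom A).
Implicit Types (z : R[i]).

Let nm_mu : nm mu = 1.
Proof. by apply: crI; rewrite -nmE mu_norm. Qed.

Lemma spectrum_eigenvector z : spectrum A z -> exists e,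
  gapped_eigenvector A z e.
Proof.
move=> Sz; have [[_ [U nU SU]] [e e0 eE]] := A_discrete Sz.
have [De Te] : Defs.eigenspace A z e by rewrite eE; exists 1; rewrite ?scale1r.
exists e; split => //.
have zE := cj_fix (eigenvalue_real A_sa De Te e0).
have /nbhs_nm[r r0 rU] := nU.
exists (r / 2); first by rewrite divr_gt0.
rewrite zE; move=> v Dv ev; apply: isolated_simple_gap ev => //.
- move=> w wz wr; apply: contrapT => Sw; move/eqP: wz; apply.
  have : (U `&` spectrum A) w by split => //; apply: rU; rewrite zE.
  by rewrite SU /= => ->.
- by rewrite -zE.
- move=> u Du Tu; have : Defs.eigenspace A z u by split => //; rewrite zE.
  by rewrite eE => -[c _ <-]; exists c.
Qed.

Lemma spectrum_real z : spectrum A z -> cj z = z.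
Proof.
move=> /spectrum_eigenvector[e [e0 De Te _]].
by have := eigenvalue_real A_sa De Te e0.
Qed.

(** An eigenvector orthogonal to [mu] is orthogonal to every [resolvent A y mu], since [A - y] acts
    on it by a nonzero scalar; these vectors are total. *)
Lemma cyclic_eigenvector z e : gapped_eigenvector A z e -> << mu, e >> != 0.
Proof.
move=> [e0 De Te _]; have zr := eigenvalue_real A_sa De Te e0.
apply/eqP => mue; move/eqP: e0; apply; apply: dense_ip0 mu_cyclic _.
move=> _ [n [c [w [wS ->]]]].
suff wi i : << w i, e >> = 0.
  rewrite /ip /inner raddf_sum big1// => i _.
  by have := wi i; rewrite /= linearZr_LR/= /ip /inner => ->; rewrite mulr0.
have [y /contrapT ry <-] := wS i; apply: ip_eq0C.
have [Dp pE] := resolventP mu ry; set p := resolvent A y mu in Dp pE *.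
have := ip_eq0C mue; rewrite -pE ipDr ipNr ipZr -(sa_sym A_sa De Dp) Te ipZl zr.
rewrite -mulrBl => /eqP; rewrite mulf_eq0 => /orP[|/eqP//].
rewrite subr_eq0 => /eqP zy; have e_eq0 : e = 0.
  transitivity (resolvent A y 0).
    by apply: resolvent_uniq => //; rewrite Te zy subrr.
  symmetry; apply: resolvent_uniq => //; first exact: op_dom0.
  by rewrite op_at0 scaler0 subrr.
by rewrite e_eq0 ip0l.
Qed.

(* Replaces the bound on the resolvent, and holds on the spectrum as well. *)
Lemma observability z : exists2 K : R, 0 < K & forall u, D u ->
  nm u <= K * (nm (A u - z *: u) + nc << mu, u >>).
Proof.
have [rz|Sz] := pselect (resolvent_set A z).
  have [c c0 cP] := resolvent_bounded_below rz.
  exists c^-1 => [|u Du]; first by rewrite invr_gt0.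
  by rewrite ler_pdivlMl//; have := cP u Du; have := nc_ge0 << mu, u >>; lra.
have [e ge] := spectrum_eigenvector Sz.
have [e0 De Te [c c0 cP]] := ge.
have m0 : 0 < nc << mu, e >> by rewrite nc_gt0 (cyclic_eigenvector ge).
set m := nc _ in m0.
have k0 : 0 <= nm e / m by rewrite divr_ge0 ?nm_ge0// ltW.
have c10 : 0 < c^-1 by rewrite invr_gt0.
(* Split [u = v + a e]: the gap gives [|v| <= X / c], and as [<mu, e>] is nonzero, [a] is controlled
   by [<mu, u>] and [|v|]. *)
exists ((1 + nm e / m) / c + nm e / m).
  by rewrite ltr_pwDl// mulr_gt0//; lra.
move=> u Du; pose a := << e, u >> / << e, e >>; pose v := u - a *: e.
have Dv : D v by apply: op_domB => //; exact: op_domZ.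
have ev : << e, v >> = 0 by rewrite /v ipDr ipNr ipZr /a divfK ?subrr// ip_neq0.
have uE : u = v + a *: e by rewrite /v subrK.
have TuE : A u - z *: u = A v - z *: v.
  by rewrite uE opD ?opZ ?Te//; [vect|exact: op_domZ].
have := cP _ Dv ev; rewrite TuE; set X := nm (A v - _) => h1.
have h2 : nc a * m <= nc << mu, u >> + nm v.
  rewrite /m -ncM -ipZr (_ : a *: e = u - v); last by rewrite /v; vect.
  rewrite ipDr ipNr; apply: le_trans (ncD _ _) _; rewrite ncN lerD2l.
  by have := CauchySchwarz_nm mu v; rewrite nm_mu mul1r.
have h3 : nc a <= (nc << mu, u >> + nm v) / m by rewrite ler_pdivlMr.
have h4 : nm u <= nm v + nc a * nm e by rewrite {1}uE -nmZ nmD.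
have h5 : nm v <= X / c by rewrite ler_pdivlMr// mulrC.
have h6 : nc a * nm e <= (nc << mu, u >> + nm v) * (nm e / m).
  by rewrite mulrCA mulrC ler_wpM2l ?nm_ge0.
have h7 : nm v * (nm e / m) <= X / c * (nm e / m) by rewrite ler_wpM2r.
have h8 : 0 <= nc << mu, u >> / c * (1 + nm e / m).
  by rewrite mulr_ge0 ?addr_ge0// divr_ge0 ?nc_ge0// ltW.
have h9 : 0 <= X * (nm e / m) by rewrite mulr_ge0// nm_ge0.
rewrite mulrDl in h6.
have -> : ((1 + nm e / m) / c + nm e / m) * (X + nc << mu, u >>) =
  X / c + X / c * (nm e / m) + nc << mu, u >> / c * (1 + nm e / m)
  + X * (nm e / m) + nc << mu, u >> * (nm e / m) by ring.
lra.
Qed.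

Definition normalized_solution z (zeta : H) (kappa : R[i]) :=
  [/\ D zeta, A zeta - cj z *: zeta = kappa *: mu & << mu, zeta >> = 1].

(** The difference [d] of two solutions is orthogonal to [mu], so [observability] bounds it by
    [A d - cj z d] alone, which is of order [|w - z|]. No resolvent appears, so [z] may be an
    eigenvalue. *)
Lemma solution_lipschitz z zeta0 kappa0 zeta1 kappa1 :
  normalized_solution z zeta0 kappa0 ->
  normalized_solution (cj z) zeta1 kappa1 ->
  exists K d : R, [/\ 0 <= K, 0 < d & forall (w : R[i]) zeta kappa,
    nc (w - z) < d -> normalized_solution w zeta kappa ->
    nm (zeta - zeta0) <= K * nc (w - z)].
Proof.
move=> [D0 E0 N0] [D1 E1 N1]; rewrite cjK in E1.
have [K0 K00 K0P] := observability (cj z).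
pose K1 := K0 * (1 + nm zeta1).
have K10 : 0 < K1 by rewrite mulr_gt0// ltr_pwDl// nm_ge0.
(* Within this radius [K1 |w - z| <= 1/2], so the [|d|] hidden in [|zeta| <= |zeta0| + |d|] is
   absorbed, at the cost of a factor 2. *)
exists (2 * K1 * nm zeta0), (1 / (2 * K1)); split.
- by apply: mulr_ge0; [apply: mulr_ge0 => //; exact: ltW|exact: nm_ge0].
- by rewrite divr_gt0// mulr_gt0.
move=> w zeta kappa wz [Dw Ew Nw]; set d := zeta - zeta0.
have Dd : D d by exact: op_domB.
have Nd : << mu, d >> = 0 by rewrite /d ipDr ipNr Nw N0 subrr.
have Ed : A d - cj z *: d = (kappa - kappa0) *: mu + (cj w - cj z) *: zeta.
  have -> : (kappa - kappa0) *: mu = kappa *: mu - kappa0 *: mu by vect.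
  by rewrite -Ew -E0 /d opB//; vect.
(* Pairing with the solution at the conjugate point eliminates [A d], since [d] is orthogonal to
   [mu]. *)
have kE : kappa - kappa0 = - (cj w - cj z) * << zeta1, zeta >>.
  have : << zeta1, A d - cj z *: d >> = 0.
    rewrite ipDr ipNr ipZr -(sa_sym A_sa D1 Dd).
    have : << A zeta1 - z *: zeta1, d >> = 0 by rewrite E1 ipZl Nd mulr0.
    by rewrite ipDl ipNl ipZl.
  rewrite Ed ipDr !ipZr (ipC mu) N1 cj1 mulr1 => /eqP.
  by rewrite addr_eq0 => /eqP ->; rewrite mulNr.
have zw : nc (cj w - cj z) = nc (w - z) by rewrite -(cjN z) -cjD nc_cj.
have := K0P _ Dd; rewrite Nd nc0 addr0 Ed => h1.
have := nmD ((kappa - kappa0) *: mu) ((cj w - cj z) *: zeta).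
rewrite !nmZ nm_mu mulr1 kE ncM ncN zw => h2.
have := CauchySchwarz_nm zeta1 zeta => h3.
have h4 : nm zeta <= nm zeta0 + nm d by rewrite (_ : zeta = zeta0 + d) ?nmD// /d; vect.
set del := nc (w - z) in wz zw h2 *; have del0 : 0 <= del := nc_ge0 _.
have h5 : del * nc << zeta1, zeta >> <= del * (nm zeta1 * nm zeta) by rewrite ler_wpM2l.
have h6 : nm d <= K1 * del * nm zeta.
  apply: le_trans h1 _; rewrite /K1 -!mulrA ler_pM2l//; rewrite kE; lra.
have h7 : K1 * del * nm zeta <= K1 * del * (nm zeta0 + nm d).
  by rewrite ler_wpM2l// mulr_ge0// ltW.
have h8 : K1 * del <= 1 / 2.
  move: wz; rewrite ltr_pdivlMr; last by apply: mulr_gt0.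
  by move/ltW; lra.
have h9 : K1 * del * nm d <= 1 / 2 * nm d by rewrite ler_wpM2r// nm_ge0.
by rewrite mulrDr in h7; lra.
Qed.

(** If [F] vanished at a nearby [cj w], then [p = resolvent A (cj w) mu] would be orthogonal to
    [mu]. [observability] gives [|p| <= 2 K], while pairing with [zeta] gives
    [1 <= |w - z| |zeta| |p|]: impossible for small [|w - z|]. *)
Lemma Ffun_neq0_near z zeta kappa : normalized_solution (cj z) zeta kappa ->
  exists2 d : R, 0 < d & forall w : R[i], nc (w - z) < d ->
    resolvent_set A (cj w) -> Ffun dot A mu (cj w) != 0.
Proof.
move=> [D1 E1 N1]; rewrite cjK in E1.
have [K K0 KP] := observability (cj z).
have N0 := nm_ge0 zeta.
have K20 : 0 < 2 * K * (1 + nm zeta) by rewrite !mulr_gt0// ltr_pwDl.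
exists (1 / (2 * K * (1 + nm zeta))); first by rewrite divr_gt0.
move=> w wz rw; apply/eqP => F0.
have [Dp pE] := resolventP mu rw; set p := resolvent A _ mu in Dp pE.
have Np : << mu, p >> = 0 by exact: F0.
have Ep : A p - cj z *: p = mu + (cj w - cj z) *: p by rewrite -pE; vect.
have zw : nc (cj w - cj z) = nc (w - z) by rewrite -(cjN z) -cjD nc_cj.
have := KP _ Dp; rewrite Np nc0 addr0 Ep => h1.
have := nmD mu ((cj w - cj z) *: p); rewrite nmZ nm_mu zw => h2.
set del := nc (w - z) in wz zw h2; have del0 : 0 <= del := nc_ge0 _.
have h3 : 1 <= del * (nm zeta * nm p).
  have : << zeta, A p - cj z *: p >> = 0.
    rewrite ipDr ipNr ipZr -(sa_sym A_sa D1 Dp).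
    have : << A zeta - z *: zeta, p >> = 0 by rewrite E1 ipZl Np mulr0.
    by rewrite ipDl ipNl ipZl.
  rewrite Ep ipDr ipZr (ipC mu) N1 cj1 => /eqP.
  rewrite addrC addr_eq0 => /eqP h; have := congr1 (@nc R) h.
  rewrite ncM ncN zw [nc 1](nc_cr 1) normr1 => <-.
  by rewrite ler_wpM2l// CauchySchwarz_nm.
move: wz; rewrite ltr_pdivlMr// => wz.
have p0 := nm_ge0 p.
have a0 : 0 <= K * del by rewrite mulr_ge0// ltW.
have h4 : K * del <= 1 / 2.
  have : 0 <= K * del * nm zeta by rewrite mulr_ge0.
  by lra.
have h5 : K * del * nm p <= 1 / 2 * nm p by rewrite ler_wpM2r.
have h6 : K * (nm (mu + (cj w - cj z) *: p)) <= K * (1 + del * nm p) by rewrite ler_pM2l.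
have h7 : nm p <= 2 * K by lra.
have : del * nm zeta * nm p <= del * nm zeta * (2 * K).
  by rewrite ler_wpM2l// mulr_ge0.
have : 0 <= del * K by rewrite mulr_ge0// ltW.
by lra.
Qed.

Local Notation Sp_infty := (spectrum_infty dot A mu).
Local Notation F := (Ffun dot A mu).

Lemma resolvent_set_cj z : resolvent_set A z -> resolvent_set A (cj z).
Proof.
move=> rz; apply: contrapT => Sz; have := spectrum_real Sz.
by rewrite cjK => zr; apply: Sz; rewrite -zr.
Qed.

Lemma spectrum_infty_cj z : ~ Sp_infty z -> ~ Sp_infty (cj z).
Proof.
move=> Sz [x hx xz]; apply: Sz; exists x => //.
by rewrite -[RHS]cjK -xz; apply/esym/cj_cr.
Qed.

(** [spectrum_infty] records only real zeros, so non-real ones must be excluded: at a zero,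
    [p = resolvent A z mu] satisfies [<p, A p> = z <p, p>], and symmetry makes [z] real. *)
Lemma Ffun_neq0 z : resolvent_set A z -> ~ Sp_infty z -> F z != 0.
Proof.
move=> rz nS; apply/eqP => F0.
have [Dp pE] := resolventP mu rz; set p := resolvent A z mu in Dp pE.
have Np : << mu, p >> = 0 by exact: F0.
have p0 : p != 0.
  apply/eqP => p0; move: pE; rewrite p0 op_at0 scaler0 subr0 => mu0.
  by have := nm_mu; rewrite -mu0 nm0 => /eqP; rewrite eq_sym oner_eq0.
have : << p, A p - z *: p >> = 0 by rewrite pE (ip_eq0C Np).
rewrite ipDr ipNr ipZr => /eqP; rewrite subr_eq0 => /eqP e1.
have := sa_sym A_sa Dp Dp; rewrite e1 (ipC p (A p)) e1 cjM -(ipC p p).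
move/(mulIf (ip_neq0 p0)) => zr.
have zE : ((complex.Re z)%:C)%C = z by exact: (esym (cj_fix zr)).
apply: nS; exists (complex.Re z) => //.
by split; rewrite zE// => /(_ rz).
Qed.

Lemma xi_regular_solution z : resolvent_set A (cj z) -> F (cj z) != 0 ->
  normalized_solution z (xi_regular dot A mu z) (F (cj z))^-1.
Proof.
move=> rz F0; rewrite /xi_regular -/(cj z).
have [Dp pE] := resolventP mu rz; set p := resolvent A (cj z) mu in Dp pE *.
split; first exact: op_domZ.
  by rewrite opZ// -[X in _ = _ *: X]pE; vect.
by rewrite ipZr -[<< _, _ >>]/(F (cj z)) mulVf.
Qed.

Lemma recipF_resolvent z : resolvent_set A z -> recipF dot A mu z = (F z)^-1.
Proof. by move=> rz; rewrite /recipF asboolF//; exact. Qed.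

Lemma eigenvector_solution z e : gapped_eigenvector A z e ->
  normalized_solution z (<< mu, e >>^-1 *: e) 0.
Proof.
move=> ge; have [e0 De Te _] := ge; split; first exact: op_domZ.
  by rewrite opZ// Te (eigenvalue_real A_sa De Te e0) scale0r; vect.
by rewrite ipZr mulVf// (cyclic_eigenvector ge).
Qed.

(** At an eigenvalue the normalized eigenvector is a solution with [kappa = 0], and
    [solution_lipschitz] shows that the regular values nearby converge to it. *)
Lemma xi_solution z : ~ Sp_infty z ->
  normalized_solution z (xi dot A mu z) (recipF dot A mu (cj z)).
Proof.
move=> nS; have [rz|Sz] := pselect (resolvent_set A z).
  rewrite /xi asboolF; last exact.
  have rcz := resolvent_set_cj rz; rewrite recipF_resolvent//.
  by apply: xi_regular_solution => //; apply: Ffun_neq0 => //; exact: spectrum_infty_cj.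
have zr := spectrum_real Sz.
have [e ge] := spectrum_eigenvector Sz; have sol := eigenvector_solution ge.
rewrite /xi asboolT// /recipF zr asboolT//.
suff -> : lim (xi_regular dot A mu w @[w --> z^']) = << mu, e >>^-1 *: e by [].
apply: cvg_lim; first exact: norm_hausdorff.
have sol' : normalized_solution (cj z) (<< mu, e >>^-1 *: e) 0 by rewrite zr.
have [K [d [K0 d0 KP]]] := solution_lipschitz sol sol'.
have [d' d'0 FP] := Ffun_neq0_near sol'.
have [d'' d''0 RP] := gapped_isolated A_sa ge.
apply/cvg_nm => eps eps0.
pose d3 := Num.min (Num.min d d') (Num.min d'' (eps / (K + 1))).
have d30 : 0 < d3 by rewrite !lt_min d0 d'0 d''0 divr_gt0// ltr_wpDl.
apply/dnbhs_nm; exists d3 => // w wz.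
rewrite nm_scalar !lt_min => /andP[/andP[wd wd'] /andP[wd'' we]].
have rw := resolvent_set_cj (RP w wz wd'').
have Fw := FP w wd' rw.
apply: le_lt_trans (KP _ _ _ wd (xi_regular_solution rw Fw)) _.
move: we; rewrite ltr_pdivlMr; last by rewrite ltr_wpDl.
by have := nc_ge0 (w - z); lra.
Qed.

(** Serves twice: for the derivative of [G_h], and for the local bound on [xi] behind uniform
    convergence. *)
Lemma xi_lipschitz z : ~ Sp_infty z ->
  exists K d : R, [/\ 0 <= K, 0 < d & forall w : R[i], nc (w - z) < d ->
    ~ Sp_infty w /\ nm (xi dot A mu w - xi dot A mu z) <= K * nc (w - z)].
Proof.
move=> nS; have sol := xi_solution nS.
have sol' := xi_solution (spectrum_infty_cj nS).
have [K [d [K0 d0 KP]]] := solution_lipschitz sol sol'.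
have [d' d'0 FP] := Ffun_neq0_near sol'.
exists K, (Num.min d d'); split => //; first by rewrite lt_min d0.
move=> w; rewrite lt_min => /andP[wd wd'].
have nSw : ~ Sp_infty w.
  move=> [x [rx Fx] xw]; move/contrapT: rx => rx.
  have cjw : cj w = w by rewrite -xw; exact: cj_cr.
  have := FP w wd'; rewrite cjw -xw Fx eqxx => /(_ rx); exact/negP.
by split => //; exact: KP (xi_solution nSw).
Qed.

(** * The perturbed operator [A_h]: spectrum, eigenvectors and [G_h] *)

Section Perturbed.
Variable h : R.
Local Notation Ah := (perturb dot A mu h).
Local Notation G := (Gfun dot A mu h).
Local Notation xi_ := (xi dot A mu).

Let AhE v : Ah v = A v + (cr h * << mu, v >>) *: mu.
Proof. by []. Qed.

Lemma perturb_self_adjoint : self_adjoint dot Ah.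
Proof.
split; first by have [] := A_sa.
move=> v w; split.
  move=> [Dv <-] u Du; rewrite -!/(ip _ _) !AhE !(ipDl, ipDr, ipZl, ipZr).
  by rewrite (sa_sym A_sa Dv Du) cjM cj_cr -(ipC mu v); ring.
move=> vw; have [Dv Av] : D v /\ A v = w - (cr h * << mu, v >>) *: mu.
  apply: (sa_adjoint A_sa) => u Du; have := vw u Du.
  rewrite -!/(ip _ _) !AhE !(ipDl, ipNl, ipDr, ipZl, ipZr) => ->.
  by rewrite cjM cj_cr -(ipC mu v); ring.
by split => //; rewrite AhE Av subrK.
Qed.

Let Ah_sym u v : D u -> D v -> << Ah u, v >> = << u, Ah v >>.
Proof. exact: (sa_sym perturb_self_adjoint). Qed.

Lemma perturb_solution z zeta kappa : normalized_solution z zeta kappa ->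
  Ah zeta - cj z *: zeta = (cr h + kappa) *: mu.
Proof.
move=> [_ E N]; rewrite AhE N mulr1 scalerDl -E; vect.
Qed.

(** The perturbation has norm [|h| |<mu, u>|] at [u], a quantity already present on the right of
    [observability]. *)
Lemma perturb_observability z : exists2 K : R, 0 < K & forall u, D u ->
  nm u <= K * (nm (Ah u - z *: u) + nc << mu, u >>).
Proof.
have [K K0 KP] := observability z; exists (K * (1 + `|h|)).
  by rewrite mulr_gt0// ltr_pwDl.
move=> u Du; apply: le_trans (KP u Du) _; rewrite -mulrA ler_pM2l//.
have -> : A u - z *: u = Ah u - z *: u - (cr h * << mu, u >>) *: mu.
  by rewrite AhE; vect.
have := nmB (Ah u - z *: u) ((cr h * << mu, u >>) *: mu).
rewrite nmZ nm_mu mulr1 ncM nc_cr.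
have : 0 <= `|h| * nm (Ah u - z *: u) by rewrite mulr_ge0// nm_ge0.
by rewrite mulrDl mulrDr; lra.
Qed.

(** Pairing [A_h u - z u] with [zeta] returns [cj g <mu, u>], so for [g] nonzero the term [<mu, u>]
    of the observability bound is itself controlled by [A_h u - z u]. *)
Lemma perturb_resolvent_set z zeta g : D zeta ->
  Ah zeta - cj z *: zeta = g *: mu -> g != 0 -> resolvent_set Ah z.
Proof.
move=> Dz Ez g0; have [K K0 KP] := perturb_observability z.
have cg : 0 < nc g by rewrite nc_gt0.
have n0 := nm_ge0 zeta.
pose K1 := K * (1 + nm zeta / nc g).
have K10 : 0 < K1 by rewrite mulr_gt0// ltr_pwDl// divr_ge0// ltW.
apply: (@resolvent_crit Ah perturb_self_adjoint K1^-1); first by rewrite invr_gt0.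
move=> u Du; rewrite ler_pdivrMl//; apply: le_trans (KP u Du) _.
rewrite /K1 -mulrA ler_pM2l// mulrDl mul1r lerD2l mulrAC ler_pdivlMr//.
have -> : nc << mu, u >> * nc g = nc << zeta, Ah u - z *: u >>.
  have -> : << zeta, Ah u - z *: u >> = cj g * << mu, u >>.
    rewrite -ipZl -Ez ipDl ipNl ipDr ipNr ipZl ipZr cjK.
    by rewrite (Ah_sym Dz Du).
  by rewrite ncM nc_cj mulrC.
exact: CauchySchwarz_nm.
Qed.

(** At a zero of [F], [p = resolvent A z mu] is orthogonal to [mu], so the perturbation does not see
    it and [(A_h - z) p = mu]. *)
Lemma perturb_spectrum_infty z : spectrum Ah z -> ~ Sp_infty z.
Proof.
move=> Sz [x [/contrapT rx Fx] xz]; apply: Sz.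
have zr : cj z = z by rewrite -xz; exact: cj_cr.
rewrite xz in rx Fx.
have [Dp pE] := resolventP mu rx; set p := resolvent A z mu in Dp pE.
have Np : << mu, p >> = 0 by exact: Fx.
apply: (@perturb_resolvent_set z p 1) => //.
by rewrite zr AhE Np mulr0 scale0r addr0 pE scale1r.
Qed.

Lemma perturb_spectrum_eigen z : spectrum Ah z ->
  [/\ cj z = z, Ah (xi_ z) = z *: xi_ z & cr h + recipF dot A mu z = 0].
Proof.
move=> Sz; have sol := xi_solution (perturb_spectrum_infty Sz).
have [Dx _ Nx] := sol; have Ez := perturb_solution sol.
have g0 : cr h + recipF dot A mu (cj z) = 0.
  by apply: contrapT => /eqP g0; apply: Sz; exact: perturb_resolvent_set Ez g0.
have x0 : xi_ z != 0.
  by apply/eqP => x0; move/eqP: Nx; rewrite x0 ip0r eq_sym oner_eq0.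
have Ahx : Ah (xi_ z) = cj z *: xi_ z.
  by apply/eqP; rewrite -subr_eq0 Ez g0 scale0r.
have zr : cj z = z.
  by have := eigenvalue_real perturb_self_adjoint Dx Ahx x0; rewrite cjK.
by rewrite zr in Ahx g0; split.
Qed.

Lemma xi_neq0 z : ~ Sp_infty z -> xi_ z != 0.
Proof.
move=> /xi_solution[_ _ Nx]; apply/eqP => x0.
by move/eqP: Nx; rewrite x0 ip0r eq_sym oner_eq0.
Qed.

(** Subtract from [v] the multiple of [xi z] that cancels [<mu, v>], not the orthogonal component:
    [observability] then loses its second term, and as [v] is orthogonal to [xi z] the norm has only
    grown. *)
Lemma perturb_gapped z : spectrum Ah z -> gapped_eigenvector Ah z (xi_ z).
Proof.
move=> Sz; have nS := perturb_spectrum_infty Sz.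
have [Dx _ Nx] := xi_solution nS; have [zr Ahx _] := perturb_spectrum_eigen Sz.
split => //; first exact: xi_neq0.
have [K K0 KP] := perturb_observability z.
exists K^-1; first by rewrite invr_gt0.
move=> v Dv xv; rewrite ler_pdivrMl//.
pose a := << mu, v >>; pose u := v - a *: xi_ z.
have Du : D u by apply: op_domB => //; exact: op_domZ.
have := KP u Du; have -> : << mu, u >> = 0.
  by rewrite /u ipDr ipNr ipZr Nx mulr1 subrr.
have -> : Ah u - z *: u = Ah v - z *: v.
  by rewrite /u opB ?opZ ?Ahx//; [vect|exact: op_domZ].
rewrite nc0 addr0; apply: le_trans.
apply: (@nm_le_orth v (- (a *: xi_ z))).
by rewrite ipNr ipZr (ip_eq0C xv) mulr0 oppr0.
Qed.

Lemma perturb_eigenspace z v : spectrum Ah z -> D v -> Ah v = z *: v ->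
  v = << mu, v >> *: xi_ z.
Proof.
move=> Sz Dv Ahv; have nS := perturb_spectrum_infty Sz.
have [Dx _ Nx] := xi_solution nS; have [zr Ahx _] := perturb_spectrum_eigen Sz.
have [K K0 KP] := perturb_observability z.
pose u := v - << mu, v >> *: xi_ z.
have Du : D u by apply: op_domB => //; exact: op_domZ.
have := KP u Du; have -> : << mu, u >> = 0.
  by rewrite /u ipDr ipNr ipZr Nx mulr1 subrr.
have -> : Ah u - z *: u = 0.
  by rewrite /u opB ?opZ ?Ahx ?Ahv//; [vect|exact: op_domZ].
rewrite nc0 nm0 addr0 mulr0 => /nm0_eq0/eqP.
by rewrite subr_eq0 => /eqP.
Qed.

Lemma perturb_total v :
  (forall z, spectrum Ah z -> << xi_ z, v >> = 0) -> v = 0.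
Proof.
move=> Sv; apply: (eigenvectors_total perturb_self_adjoint).
  by move=> z Sz; exists (xi_ z); exact: perturb_gapped.
move=> z e De Ahe; have [rz|Sz] := pselect (resolvent_set Ah z).
  suff -> : e = 0 by exact: ip0l.
  transitivity (resolvent Ah z 0).
    by apply: resolvent_uniq => //; rewrite Ahe subrr.
  symmetry; apply: resolvent_uniq => //; first exact: op_dom0.
  by rewrite op_at0 scaler0 subrr.
by rewrite (perturb_eigenspace Sz De Ahe) ipZl Sv// mulr0.
Qed.

Lemma xi_orthogonal z (w : R[i]) : spectrum Ah z -> spectrum Ah w -> z != w ->
  << xi_ z, xi_ w >> = 0.
Proof.
move=> Sz Sw zw; have [zr Ez _] := perturb_spectrum_eigen Sz.
have [_ Ew _] := perturb_spectrum_eigen Sw.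
have [Dz _ _] := xi_solution (perturb_spectrum_infty Sz).
have [Dw _ _] := xi_solution (perturb_spectrum_infty Sw).
have := Ah_sym Dz Dw; rewrite Ez Ew ipZl ipZr zr => /eqP.
by rewrite -subr_eq0 -mulrBl mulf_eq0 subr_eq0 (negPf zw) => /eqP.
Qed.

(** Off the spectrum of [A_h], [xi (cj z)] is [g] times the resolvent of [A_h] at [mu]; pairing with
    [mu] gives [g F_h = 1]. On the spectrum both sides vanish. *)
Lemma GfunE z : ~ Sp_infty z -> G z = cr h + recipF dot A mu z.
Proof.
move=> nS; have [rz|Sz] := pselect (resolvent_set Ah z); last first.
  by have [_ _ ->] := perturb_spectrum_eigen Sz; rewrite /Gfun /recipF asboolT.
rewrite /Gfun {1}/recipF asboolF; last exact.
have sol := xi_solution (spectrum_infty_cj nS).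
have := perturb_solution sol; have [Dx _ Nx] := sol; rewrite cjK.
set x := xi dot A mu (cj z) in Dx Nx *; set g := cr h + _ => E.
have [Dp pE] := resolventP mu rz; set p := resolvent Ah z mu in Dp pE.
have xE : x = g *: p.
  transitivity (resolvent Ah z (g *: mu)); first exact: resolvent_uniq.
  symmetry; apply: resolvent_uniq => //; first exact: op_domZ.
  by rewrite opZ// -[X in _ = _ *: X]pE; vect.
have gF : g * Ffun dot Ah mu z = 1.
  by rewrite -Nx xE ipZr.
have F0 : Ffun dot Ah mu z != 0.
  by apply/eqP => F0; move/eqP: gF; rewrite F0 mulr0 eq_sym oner_eq0.
by apply: (mulIf F0); rewrite gF mulVf.
Qed.

(** Schwarz reflection for [1 / F], from the symmetry of [A] between the solutions at [z] and
    [cj z]. *)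
Lemma recipF_cj z : ~ Sp_infty z -> cj (recipF dot A mu (cj z)) = recipF dot A mu z.
Proof.
move=> nS; have [D1 E1 N1] := xi_solution nS.
have [D2 E2 N2] := xi_solution (spectrum_infty_cj nS).
rewrite cjK in E2; set y := xi dot A mu (cj z) in D2 E2 N2.
have : << A (xi_ z) - cj z *: xi_ z, y >> = << xi_ z, A y - z *: y >>.
  by rewrite ipDl ipNl ipDr ipNr ipZl ipZr cjK (sa_sym A_sa D1 D2).
by rewrite E1 E2 ipZl ipZr N2 (ipC mu) N1 cj1 !mulr1.
Qed.

Lemma Gfun_factor z x : ~ Sp_infty z -> spectrum Ah x ->
  G z = (x - z) * << xi_ z, xi_ x >>.
Proof.
move=> nS Sx; have [_ Ex _] := perturb_spectrum_eigen Sx.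
have [Dx _ Nx] := xi_solution (perturb_spectrum_infty Sx).
have sol := xi_solution nS; have [Dz _ _] := sol.
have : << Ah (xi_ z) - cj z *: xi_ z, xi_ x >> = (x - z) * << xi_ z, xi_ x >>.
  by rewrite ipDl ipNl ipZl cjK (Ah_sym Dz Dx) Ex ipZr mulrBl.
move=> <-; rewrite (perturb_solution sol) ipZl Nx mulr1 cjD cj_cr recipF_cj//.
exact: GfunE.
Qed.

Lemma derive1_Gfun x : spectrum Ah x -> derive1 G x = - << xi_ x, xi_ x >>.
Proof.
move=> Sx; have nS := perturb_spectrum_infty Sx.
rewrite /derive1; apply: cvg_lim; first exact: norm_hausdorff.
have [K [d [K0 d0 KP]]] := xi_lipschitz nS.
have n0 := nm_ge0 (xi_ x).
apply/cvg_nm => eps eps0.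
pose L := K * nm (xi_ x) + 1.
have L0 : 0 < L by rewrite ltr_wpDl// mulr_ge0.
apply/dnbhs_nm; exists (Num.min d (eps / L)); first by rewrite lt_min d0 divr_gt0.
move=> k k0; rewrite nm_scalar subr0 lt_min => /andP[kd ke].
have kx : k + x - x = k by rewrite addrK.
have [nSk Kk] : ~ Sp_infty (k + x) /\ nm (xi_ (k + x) - xi_ x) <= K * nc k.
  by have := KP (k + x); rewrite kx; exact.
suff : nc (k^-1 * (G (k + x) - G x) - - << xi_ x, xi_ x >>) < eps by exact.
rewrite (Gfun_factor nSk Sx) (Gfun_factor nS Sx) subrr mul0r subr0.
rewrite (_ : _ - _ = - << xi_ (k + x) - xi_ x, xi_ x >>); last first.
  by rewrite ipDl ipNl; field.
rewrite ncN; apply: le_lt_trans (CauchySchwarz_nm _ _) _.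
apply: (@le_lt_trans _ _ (K * nc k * nm (xi_ x))); first by rewrite ler_wpM2r.
move: ke; rewrite ltr_pdivlMr// /L mulrDr mulr1.
by have := nc_ge0 k; lra.
Qed.

(** * Orthogonal projections on finitely many eigenvectors of [A_h] *)

Definition proj_xi (phi : H) x : H :=
  (<< xi_ x, phi >> / << xi_ x, xi_ x >>) *: xi_ x.

(** [Gquot] is [- <xi z, xi x>] in both cases of its definition, so filling the singularity agrees
    with the factorization of [G_h]. *)
Lemma sampling_termE (f : R[i] -> R[i]) phi z x : ~ Sp_infty z -> spectrum Ah x ->
  f x = << xi_ x, phi >> ->
  sampling_term dot A mu h f x z = << xi_ z, proj_xi phi x >>.
Proof.
move=> nS Sx fx.
have x0 := ip_neq0 (xi_neq0 (perturb_spectrum_infty Sx)).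
have -> : sampling_term dot A mu h f x z
    = - << xi_ z, xi_ x >> / - << xi_ x, xi_ x >> * << xi_ x, phi >>.
  rewrite /sampling_term -fx derive1_Gfun//; congr (_ / _ * _).
  rewrite /Gquot; case: eqVneq => [->|zx]; first exact: derive1_Gfun.
  have zx0 : z - x != 0 by rewrite subr_eq0.
  by rewrite (Gfun_factor nS Sx); field.
by rewrite /proj_xi ipZr; field.
Qed.

Local Notation I := (set_type (spectrum Ah)).

Definition proj_sum (J : {fset I}) phi : H := \sum_(i <- J) proj_xi phi (val i).

Let Sp (i : I) : spectrum Ah (val i).
Proof. exact: set_valP. Qed.

Let ip_xi (i : I) : << xi_ (val i), xi_ (val i) >> != 0.
Proof. by apply/ip_neq0/xi_neq0/perturb_spectrum_infty/(@Sp i). Qed.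

Let val_neq (i j : I) : i != j -> val i != val j.
Proof. by rewrite (inj_eq val_inj). Qed.

Lemma ip_sumr (J : Type) (s : seq J) (P : pred J) (v : J -> H) u :
  << u, \sum_(i <- s | P i) v i >> = \sum_(i <- s | P i) << u, v i >>.
Proof. exact: (big_morph (ip u) (fun v w => ipDr v w u) (ip0r u)). Qed.

Lemma ip_proj_sum (J : {fset I}) (j : I) phi : j \in J ->
  << xi_ (val j), proj_sum J phi >> = << xi_ (val j), phi >>.
Proof.
move=> jJ; rewrite /proj_sum ip_sumr (bigD1_seq j jJ (fset_uniq J)) /=.
rewrite [X in _ + X]big1 => [|i ij].
  by rewrite /proj_xi ipZr divfK ?ip_xi// addr0.
have xij := xi_orthogonal (@Sp i) (@Sp j) (val_neq ij).
by rewrite /proj_xi ipZr (ip_eq0C xij) mulr0.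
Qed.

Lemma proj_sum_orth (J : {fset I}) phi psi :
  << phi - proj_sum J phi, proj_sum J psi >> = 0.
Proof.
rewrite {2}/proj_sum ip_sumr big1_seq// => i /andP[_ iJ].
have xi0 : << xi_ (val i), phi - proj_sum J phi >> = 0.
  by rewrite ipDr ipNr ip_proj_sum// subrr.
by rewrite /proj_xi ipZr (ip_eq0C xi0) mulr0.
Qed.

Lemma proj_sum_linear (J : {fset I}) a phi psi :
  proj_sum J (a *: phi + psi) = a *: proj_sum J phi + proj_sum J psi.
Proof.
rewrite /proj_sum scaler_sumr -big_split /=; apply: eq_bigr => i _.
by rewrite /proj_xi ipDr ipZr; vect.
Qed.

Lemma proj_sum_xi (J : {fset I}) (j : I) : j \in J ->
  proj_sum J (xi_ (val j)) = xi_ (val j).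
Proof.
move=> jJ; rewrite /proj_sum (bigD1_seq j jJ (fset_uniq J)) /=.
rewrite [X in _ + X]big1 => [|i ij].
  by rewrite addr0 /proj_xi divff ?scale1r ?ip_xi.
have xij := xi_orthogonal (@Sp i) (@Sp j) (val_neq ij).
by rewrite /proj_xi xij mul0r scale0r.
Qed.

(** The vectors eventually fixed by the projections form a subspace containing every [xi x], dense
    by [perturb_total]. Since a projection is a best approximation, closeness of [phi] to one fixed
    vector suffices. *)
Lemma proj_sum_cvg phi (e : R) : 0 < e ->
  \forall J \near @totally I, nm (phi - proj_sum J phi) < e.
Proof.
have FF : Filter (@totally I) by apply: filter_filter; exact: totally_filter.
move=> e0; pose M := [set m | \forall J \near @totally I, proj_sum J m = m].
have M0 : M 0.
  apply: nearW => J; have := proj_sum_linear J (-1) 0 0.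
  by rewrite !scaleN1r !addNr.
have dM : dense M.
  apply: dense_orth => //.
    move=> a u v Mu Mv; near=> J; rewrite proj_sum_linear.
    by rewrite (near Mu J) ?(near Mv J).
  move=> u Mu; apply: perturb_total => z Sz; apply: Mu.
  exists [fset (SigSub (mem_set Sz) : I)]%fset => // J; rewrite /= fsub1set => SJ.
  exact: (proj_sum_xi SJ).
have /dense_nm /(_ phi e e0) [m Mm mphi] := dM.
rewrite nmBC in mphi; near=> J; apply: le_lt_trans mphi.
have PJm : proj_sum J m = m by near: J.
rewrite (_ : phi - m = (phi - proj_sum J phi) + proj_sum J (phi - m)).
  by apply: nm_le_orth; exact: proj_sum_orth.
by rewrite addrC -scaleN1r proj_sum_linear PJm; vect.
Unshelve. all: by end_near. Qed.

(** * Convergence of the sampling series *)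

Section Sampling.
Variables (f : R[i] -> R[i]) (phi : H).
Hypothesis f_phi : forall z, ~ Sp_infty z -> f z = Phi dot A mu phi z.

Lemma sampling_sum_error (J : {fset I}) z : ~ Sp_infty z ->
  f z - sampling_sum f J z = << xi_ z, phi - proj_sum J phi >>.
Proof.
move=> nS; rewrite ipDr ipNr f_phi//; congr (_ - _).
rewrite /sampling_sum /partial_sum /proj_sum ip_sumr big_seq_fsetE.
apply: eq_bigr => i _.
apply: sampling_termE => //.
by rewrite f_phi//; exact: perturb_spectrum_infty (@Sp (val i)).
Qed.

(** The error at [w] is at most [|xi w|] times the projection error, which is independent of [w].
    The first factor is bounded near each point of [K], and compactness is used in its near-covering
    form. *)
Lemma sampling_sum_uniform (K : set R[i]) (e : R) : compact K ->
  K `<=` ~` Sp_infty -> 0 < e ->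
  \forall J \near @totally I, forall z, K z -> nc (f z - sampling_sum f J z) < e.
Proof.
move=> /compact_near_coveringP cK KS e0.
have FF : Filter (@totally I) by apply: filter_filter; exact: totally_filter.
apply: (cK _ _ (fun J z => nc (f z - sampling_sum f J z) < e) FF) => z /KS nS.
have [L [d [L0 d0 dL]]] := xi_lipschitz nS.
pose B := nm (xi_ z) + L * d + 1.
have B0 : 0 < B by rewrite ltr_wpDl// addr_ge0 ?nm_ge0// mulr_ge0// ltW.
exists ([set w | nc (w - z) < d], [set J | nm (phi - proj_sum J phi) < e / B]).
  split => /=; first by apply/nbhs_nm; exists d.
  by apply: proj_sum_cvg; rewrite divr_gt0.
move=> [w J] /= [wd Je]; have [nSw wL] := dL w wd.
rewrite sampling_sum_error//; apply: le_lt_trans (CauchySchwarz_nm _ _) _.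
have wB : nm (xi_ w) <= B.
  have := nmD (xi_ w - xi_ z) (xi_ z); rewrite subrK.
  have : L * nc (w - z) <= L * d by rewrite ler_wpM2l// ltW.
  by rewrite /B; lra.
apply: (@le_lt_trans _ _ (B * nm (phi - proj_sum J phi))).
  by rewrite ler_wpM2r ?nm_ge0.
by rewrite mulrC -ltr_pdivlMr.
Qed.

End Sampling.
End Perturbed.
End CyclicOperator.

End Hilbert.

Unset Implicit Arguments.

Theorem proposition1 (R : realType) (H : completeNormedModType R[i])
  (dot : {dot H for (Num.conj : R[i] -> R[i])})
  (dot_norm : forall u : H, inner dot u u = `|u| ^+ 2)
  (H_separable : separable H)
  (A : operator H) (mu : H)
  (A_sa : self_adjoint dot A)
  (A_discrete : discrete_simple_spectrum A)
  (mu_cyclic : cyclic A mu)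
  (mu_norm : `|mu| = 1)
  (h : R) :
  (forall z : R[i], ~ spectrum_infty dot A mu z ->
     Gfun dot A mu h z = (h%:C)%C + recipF dot A mu z) /\
  forall f : R[i] -> R[i], Hhat dot A mu f ->
    (forall z : R[i], ~ spectrum_infty dot A mu z ->
       sampling_sum f J z @[J --> @totally (set_type (spectrum (perturb dot A mu h)))] --> f z) /\
    (forall K : set R[i], compact K -> K `<=` ~` spectrum_infty dot A mu ->
       {uniform K, @sampling_sum R H dot A mu h f @ totally --> f}).
Proof.
split=> [z nS|f [phi f_phi]]; first exact: GfunE.
have unif := @sampling_sum_uniform _ _ _ dot_norm _ _ A_sa A_discrete mu_cyclic
  mu_norm h _ _ f_phi.
have FF : Filter (@totally (set_type (spectrum (perturb dot A mu h)))).
  by apply: filter_filter; exact: totally_filter.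
split=> [z nS|K cK KS].
  apply/cvg_nm => e e0.
  (* Pointwise convergence is uniform convergence on a one-point compact set. *)
  have [||J0 _ J0e] := unif [set z] e _ _ e0.
  - exact: compact_set1.
  - by move=> _ ->.
  exists J0 => // J /J0e /(_ z erefl); rewrite -opprB ncN; exact.
move=> P /uniform_nbhs[E [entE EP]].
have [_ /pos_cr[e e0 ->] eE] : exists2 e : R[i], 0 < e &
    [set xy | ball xy.1 e xy.2] `<=` E.
  by move: entE; rewrite -entourage_ballE => -[e /= e0 eE]; exists e.
have [J0 _ J0e] := unif K e cK KS e0.
exists J0 => // J /J0e Je; apply: EP => y Ky; apply: eE => /=.
by rewrite -ball_normE /= ncE ltcr; exact: Je.
Qed.
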